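(* Let $D$ be a disjoint mixed hypergraph. Then the incidence matrix $M(D)$ is totally unimodular if and only if $D$ contains neither a mixed odd cycle nor a mixed tree house.
   Context: A matrix is totally unimodular (TU) if every square submatrix has determinant in $\{0,\pm1\}$. A mixed hypergraph is a pair $D=(V,A)$ where $V=V(D)$ is a finite set and $A=A(D)$ is a finite multiset of hyperarcs $a=(S(a),T(a))$ with $S(a),T(a)\subseteq V$ disjoint and not both empty (copies of the same hyperarc are distinguished). Its incidence matrix $M(D)\in\{0,\pm1\}^{V\times A}$ has $M(D)_{v,a}=1$ if $v\in S(a)$, $-1$ if $v\in T(a)$, and $0$ otherwise. The underlying hypergraph of $D$ has vertex set $V$ and hyperedge multiset $\{S(a)\cup T(a):a\in A\}$. $D$ is disjoint if the sets $S(a)\cup T(a)$, over all $a\in A$ with $|S(a)\cup T(a)|\ge 4$, are pairwise disjoint. A mixed hypergraph $H$ with $V(H)\subseteq V(D)$ is a partial subhypergraph of $D$ if there is an injection $\iota\colon A(H)\to A(D)$ with $S(f)=S(\iota(f))\cap V(H)$ and $T(f)=T(\iota(f))\cap V(H)$ for all $f\in A(H)$. $D$ contains $H$ if $H$ is isomorphic to a partial subhypergraph of $D$. For $U\subseteq V(D)$ and $F\subseteq A(D)$, $D[U,F]$ is the partial subhypergraph with vertex set $U$ and hyperarcs $(S(a)\cap U,T(a)\cap U)$ for those $a\in F$ for which this is not $(\emptyset,\emptyset)$. A mixed path (respectively mixed cycle) is a mixed hypergraph whose underlying hypergraph is a path (respectively a cycle) in the usual graph sense, with all edges of size $2$; parallel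 edges are allowed, so a cycle of length $2$ consists of two parallel edges. For a hyperarc $a$ with $|S(a)\cup T(a)|=2$, $\mathrm{par}(a)=0$ if $|S(a)|=|T(a)|=1$, and $\mathrm{par}(a)=1$ if $|S(a)|=2$ or $|T(a)|=2$. The parity of a mixed path or mixed cycle $P$ is $\sum_{a\in A(P)}\mathrm{par}(a) \bmod 2$, and $P$ is called odd or even accordingly. A mixed odd cycle is a mixed cycle that is odd. A mixed tree house is a mixed hypergraph $D$ consisting of a hyperarc $h$ with $S(h)\cup T(h)=\{r,\ell_1,\ell_2,\ell_3\}$ of size $4$ and, for each $i\in\{1,2,3\}$, a mixed $r$-$\ell_i$-path $P_i$, such that the sets $V(P_i)\setminus\{r\}$, $i\in\{1,2,3\}$, are pairwise disjoint, and such that for each $i$ the mixed cycle $D[V(P_i),A(P_i)\cup\{h\}]$ is even. *)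

(* Defs.v *)
From HB Require Import structures.
From mathcomp Require Import all_boot all_order all_algebra.

Set Implicit Arguments.
Unset Strict Implicit.
Unset Printing Implicit Defensive.

Import GRing.Theory Num.Theory.
Local Open Scope ring_scope.

(* The rows and columns of M need not carry a meaningful order, so a submatrix
   is selected by arbitrary injections; reordering only changes the sign of the
   determinant. *)
Definition totally_unimodular (m n : nat) (M : 'M[int]_(m, n)) : Prop :=
  forall (k : nat) (f : 'I_k -> 'I_m) (g : 'I_k -> 'I_n),
    injective f -> injective g ->
    [\/ \det (mxsub f g M) = 0, \det (mxsub f g M) = 1
      | \det (mxsub f g M) = -1].

(* V is only an ambient type from which vertices are taken.  The multiset of
   hyperedges is an indexed family: distinct indices may have the same ends. *)
Record hypergraph (V : finType) := Hypergraph {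
  hvert : {set V};
  hedge : finType;
  ends : hedge -> {set V};
  ends_sub : forall e, ends e \subset hvert
}.

Record mixed_hypergraph (V : finType) := MixedHypergraph {
  vert : {set V};
  arc : finType;
  src : arc -> {set V};
  tgt : arc -> {set V};
  src_sub : forall a, src a \subset vert;
  tgt_sub : forall a, tgt a \subset vert;
  src_tgt_disjoint : forall a, [disjoint src a & tgt a];
  src_tgt_neq0 : forall a, src a :|: tgt a != set0
}.

Definition supp (V : finType) (D : mixed_hypergraph V) (a : arc D) : {set V} :=
  src a :|: tgt a.

Definition incidence (V : finType) (D : mixed_hypergraph V)
    (v : V) (a : arc D) : int :=
  if v \in src a then 1 else if v \in tgt a then -1 else 0.

Definition incidence_mx (V : finType) (D : mixed_hypergraph V) :
    'M[int]_(#|vert D|, #|{: arc D}|) :=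
  \matrix_(i, j) incidence (enum_val i) (enum_val j).

Lemma supp_sub (V : finType) (D : mixed_hypergraph V) (a : arc D) :
  supp a \subset vert D.
Proof. by rewrite subUset src_sub tgt_sub. Qed.

Definition underlying (V : finType) (D : mixed_hypergraph V) : hypergraph V :=
  Hypergraph (@supp_sub V D).

Definition disjoint_mixed (V : finType) (D : mixed_hypergraph V) : Prop :=
  forall a b : arc D, a != b -> (4 <= #|supp a|)%N -> (4 <= #|supp b|)%N ->
    [disjoint supp a & supp b].

Definition partial_subhypergraph (V : finType) (H D : mixed_hypergraph V) :
    Prop :=
  vert H \subset vert D /\
  exists iota : arc H -> arc D,
    [/\ injective iota,
        forall f, src f = src (iota f) :&: vert H
      & forall f, tgt f = tgt (iota f) :&: vert H].

Definition isomorphic (V W : finType)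
    (H : mixed_hypergraph V) (K : mixed_hypergraph W) : Prop :=
  exists (phi : {x | x \in vert H} -> {y | y \in vert K})
         (psi : arc H -> arc K),
    [/\ bijective phi, bijective psi,
        forall x a, (val (phi x) \in src (psi a)) = (val x \in src a)
      & forall x a, (val (phi x) \in tgt (psi a)) = (val x \in tgt a)].

Definition contains (V W : finType)
    (D : mixed_hypergraph V) (H : mixed_hypergraph W) : Prop :=
  exists K : mixed_hypergraph V, partial_subhypergraph K D /\ isomorphic H K.

Section Restriction.
Variables (V : finType) (D : mixed_hypergraph V) (U : {set V}) (F : {set arc D}).

Definition restr_arc : finType :=
  {a : arc D | (a \in F) && ((src a :&: U) :|: (tgt a :&: U) != set0)}.

Definition restr_src (a : restr_arc) : {set V} := src (val a) :&: U.
Definition restr_tgt (a : restr_arc) : {set V} := tgt (val a) :&: U.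

Lemma restr_src_sub a : restr_src a \subset U.
Proof. exact: subsetIr. Qed.

Lemma restr_tgt_sub a : restr_tgt a \subset U.
Proof. exact: subsetIr. Qed.

Lemma restr_disjoint a : [disjoint restr_src a & restr_tgt a].
Proof.
apply: disjointWl (subsetIl _ _) _.
exact: disjointWr (subsetIl _ _) (src_tgt_disjoint _).
Qed.

Lemma restr_neq0 a : restr_src a :|: restr_tgt a != set0.
Proof. by case/andP: (valP a). Qed.

(* D[U, F]; meant for U \subset vert D. *)
Definition restr : mixed_hypergraph V :=
  MixedHypergraph restr_src_sub restr_tgt_sub restr_disjoint restr_neq0.
End Restriction.

Definition is_path (V : finType) (G : hypergraph V) (s t : V) : Prop :=
  exists (n : nat) (v : 'I_n.+1 -> V) (e : 'I_n -> hedge G),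
    [/\ injective v, bijective e, hvert G = [set v i | i : 'I_n.+1],
        forall i : 'I_n,
          ends (e i) = [set v (widen_ord (leqnSn n) i); v (lift ord0 i)]
      & v ord0 = s /\ v ord_max = t].

(* ordS is the cyclic successor on 'I_n. *)
Definition is_cycle (V : finType) (G : hypergraph V) : Prop :=
  exists (n : nat) (v : 'I_n -> V) (e : 'I_n -> hedge G),
    [/\ (2 <= n)%N, injective v, bijective e, hvert G = [set v i | i : 'I_n]
      & forall i : 'I_n, ends (e i) = [set v i; v (ordS i)]].

Definition mixed_path (V : finType) (P : mixed_hypergraph V) (s t : V) : Prop :=
  is_path (underlying P) s t.

Definition mixed_cycle (V : finType) (C : mixed_hypergraph V) : Prop :=
  is_cycle (underlying C).

(* Only meaningful when #|supp a| = 2. *)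
Definition par (V : finType) (D : mixed_hypergraph V) (a : arc D) : nat :=
  ((#|src a| == 2) || (#|tgt a| == 2))%N.

Definition odd_parity (V : finType) (D : mixed_hypergraph V) : bool :=
  odd (\sum_(a : arc D) par a)%N.

Definition mixed_odd_cycle (V : finType) (C : mixed_hypergraph V) : Prop :=
  mixed_cycle C /\ odd_parity C.

Definition mixed_even_cycle (V : finType) (C : mixed_hypergraph V) : Prop :=
  mixed_cycle C /\ ~~ odd_parity C.

(* The path P_i has vertex set U i and its hyperarcs are those in F i, taken
   whole (supp a \subset U i), so that P_i is restr (U i) (F i). *)
Definition mixed_tree_house (V : finType) (D : mixed_hypergraph V) : Prop :=
  exists (h : arc D) (r : V) (l : 'I_3 -> V)
         (U : 'I_3 -> {set V}) (F : 'I_3 -> {set arc D}),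
    [/\ supp h = r |: [set l i | i : 'I_3] /\ #|supp h| = 4%N,
        vert D = \bigcup_i U i /\ [set: arc D] = h |: \bigcup_i F i,
        forall i, (forall a, a \in F i -> supp a \subset U i) /\
                  mixed_path (restr (U i) (F i)) r (l i),
        forall i j, i != j -> [disjoint U i :\ r & U j :\ r]
      & forall i, mixed_even_cycle (restr (U i) (h |: F i))].

(* Main.v *)
From Stdlib Require Import Classical_Prop.
From mathcomp Require Import all_boot all_order all_algebra.
From mathcomp Require Import zify ring.
Require Import Defs.

(** Total unimodularity rules out both obstructions because of a parity
    argument.  If all columns of a totally unimodular matrix have even sums, its
    rows are linearly dependent: a nonzero minor using all the rows would be 1
    or -1, but the rows add up to an even vector, so it is even
    ([even_columns_dependent]).  In a mixed odd cycle and in a mixed tree house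
    every hyperarc has two or four ends, while a linear relation between the
    rows changes by the factor (-1)^par along each hyperarc of size 2.  Going
    round an odd cycle it returns with the opposite sign; in a tree house it
    arrives at the three leaves so that the hyperarc of size 4 sums to -2 times
    the contribution of the root.  So the relation vanishes.

    Conversely let [A] be a square submatrix of least order whose determinant d
    is not 0, 1 or -1, and let S be its adjugate.  All entries of S are 1 or -1
    ([adj_pm1]), so A S = S A = d I says that row h of S is a weighting of
    the rows of [A] by signs which is balanced on every column except h.
    Moreover no integral combination of the rows of [A] is a unit vector
    ([no_integral_inverse_row]).  Hence columns have even size; as the columns
    of size at least 4 are disjoint, there is one of size 2 and so d is 2 or -2.

    If all columns have size 2, an induced path that avoids column h between
    the two rows of h closes to a cycle, and weighting it by row h of S shows
    that the cycle is odd.  Otherwise let h be a column of size at least 4.  It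
    contains a row r whose term in the expansion of d has the wrong sign, and
    then r lies in precisely three further columns, all of size 2.  For another
    row j the relation (A S) r j = 0 has four terms equal to 1 or -1, so the
    term of h agrees with that of exactly one f of these three columns; this
    partitions the remaining rows into three branches.  On the branch of f, row
    h of S is balanced on every column except h and f, and therefore h can be
    reached from f inside the branch: otherwise truncating the weighting to the
    rows that can be reached gives an integral combination equal to a unit
    vector.  Take such a route of least weight in each branch.  With r and h it
    forms an induced cycle, which is even or already the odd cycle wanted.
    Three routes with no adjacency between them form a tree house.  If two of
    them are adjacent, some part of the second is an ear joining a row to a
    column of the even cycle given by the first ([light_routes_clean]), and an
    even cycle with such an ear contains an odd one ([ear_odd_hole]).

    Cycles and paths live in the bipartite graph of rows and columns.  The edge
    between row v and column c has weight - A v c in the direction from v to c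
    and A v c in the direction from c to v.  A cycle of the graph is odd exactly
    when the product of its weights is -1, and reversing a path multiplies its
    product by -1 to the power of its length. *)

Set Implicit Arguments.
Unset Strict Implicit.
Unset Printing Implicit Defensive.

Import GRing.Theory Num.Theory.
Local Open Scope ring_scope.

(** * Signed walks and induced cycles in a skew-weighted bipartite graph *)

Section SkewGraph.
Variables (N : finType) (w : N -> N -> int) (side : pred N).
Hypothesis w_skew : forall x y, w y x = - w x y.
Hypothesis w_unit : forall x y, w x y != 0 -> w x y * w x y = 1.
Hypothesis w_side : forall x y, w x y != 0 -> side y = ~~ side x.

Definition adj x y := w x y != 0.

Lemma adj_sym x y : adj x y = adj y x.
Proof. by rewrite /adj w_skew oppr_eq0. Qed.

Lemma adj_irr x : adj x x = false.
Proof. by apply/negbTE/negP => /w_side; case: (side x). Qed.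

Fixpoint walk_sign x s : int :=
  if s is y :: s' then w x y * walk_sign y s' else 1.

Definition cycle_sign s : int :=
  if s is x :: p then walk_sign x (rcons p x) else 1.

(** Bounding the number of neighbours on the cycle by two expresses that
    there is no chord, in a form that survives rotation and concatenation.  The
    size bound excludes an edge walked back and forth. *)
Definition hole s := [&& uniq s, 2 < size s, cycle adj s
  & all (fun u => count (adj u) s <= 2) s]%N.

Lemma walk_sign_cat x s1 s2 :
  walk_sign x (s1 ++ s2) = walk_sign x s1 * walk_sign (last x s1) s2.
Proof. by elim: s1 x => [|y s IH] x /=; rewrite ?mul1r // IH mulrA. Qed.

Lemma walk_sign_rcons x s y :
  walk_sign x (rcons s y) = walk_sign x s * w (last x s) y.
Proof. by rewrite -cats1 walk_sign_cat /= mulr1. Qed.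

(** Every step contributes a factor -1 because the weights are skew. *)
Lemma walk_sign_rev x s :
  walk_sign (last x s) (rev (belast x s)) = (-1) ^+ size s * walk_sign x s.
Proof.
elim: s x => [|y s IH] x /=; first by rewrite mulr1.
rewrite rev_cons walk_sign_rcons IH exprS.
have -> : last (last y s) (rev (belast y s)) = y.
  by case: s {IH} => // z s; rewrite /= rev_cons last_rcons.
by rewrite w_skew; ring.
Qed.

Lemma walk_sign_sqr x s : path adj x s -> walk_sign x s * walk_sign x s = 1.
Proof.
elim: s x => [|y s IH] x /=; first by rewrite mulr1.
by case/andP=> xy ys; rewrite mulrACA w_unit // IH // mulr1.
Qed.

Lemma side_last x s : path adj x s -> side (last x s) = side x (+) odd (size s).
Proof.
elim: s x => [|y s IH] x /=; first by rewrite addbF.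
by case/andP=> /w_side yx ys; rewrite IH // yx; case: (side x); case: odd.
Qed.

Lemma cycle_sign_rot n s : cycle_sign (rot n s) = cycle_sign s.
Proof.
rewrite -{2}(cat_take_drop n s) /rot.
case: (take n s) => [|x a]; first by rewrite cats0.
case: (drop n s) => [|y b]; first by rewrite cats0.
rewrite /= !rcons_cat /= -!cat_rcons !walk_sign_cat !last_rcons.
by rewrite mulrC.
Qed.

Lemma hole_rot n s : hole (rot n s) = hole s.
Proof.
rewrite /hole rot_uniq size_rot rot_cycle; do 3![congr (_ && _)].
have pr : perm_eq (rot n s) s by rewrite perm_rot.
rewrite (perm_all _ pr); apply: eq_all => u.
by rewrite (permP pr).
Qed.

Lemma cycle_sign_pm s : cycle adj s -> cycle_sign s = 1 \/ cycle_sign s = -1.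
Proof.
case: s => [|x p] /=; first by left.
by move/walk_sign_sqr=> h; have := h; nia.
Qed.

(** The cycle and the ear form three internally disjoint paths
    between x and y, all of odd length because x and y lie on different sides.
    Each of the three cycles walks one of its two paths backwards, so the
    product of their signs is (-1)^3 and, the given cycle being even, one of the
    other two is odd.  Both are induced as x and y are not adjacent. *)
Lemma ear_odd_hole x l1 y l2 q :
  hole (x :: l1 ++ y :: l2) -> cycle_sign (x :: l1 ++ y :: l2) = 1 ->
  side x != side y -> ~~ adj x y ->
  path adj x (rcons q y) -> uniq (x :: q ++ y :: l1 ++ l2) ->
  {in q & l1 ++ l2, forall u v, ~~ adj u v} ->
  (count (adj x) q <= 1)%N -> (count (adj y) q <= 1)%N ->
  {in q, forall u, count (adj u) [:: x, y & q] <= 2}%N ->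
  exists2 s, hole s & cycle_sign s = -1.
Proof.
move=> hS sgS sxy nxy pq uq clean cx cy cq.
case/and4P: hS => uS _ cS /allP chS.
have cleanl : {in q & l1, forall u v, ~~ adj u v}.
  by move=> u v uq' vl; apply: clean => //; rewrite mem_cat vl.
have cleanr : {in q & l2, forall u v, ~~ adj u v}.
  by move=> u v uq' vl; apply: clean => //; rewrite mem_cat vl orbT.
have pS : path adj x (l1 ++ y :: rcons l2 x) by move: cS; rewrite /= rcons_cat.
move: (pS); rewrite cat_path /= => /and3P[p1 a1 p2].
have l1n : l1 != [::] by apply: contraNneq nxy => l0; rewrite l0 in a1.
have l2n : l2 != [::].
  apply: contraNneq nxy => l0; move: p2; rewrite l0 /= andbT.
  by rewrite adj_sym.
have qn : q != [::].
  by apply: contraNneq nxy => l0; move: pq; rewrite l0 /= andbT.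
have hasc z (l : seq N) : z \in l -> adj x z -> (0 < count (adj x) l)%N.
  by move=> zl xz; rewrite -has_count; apply/hasP; exists z.
have hasy z (l : seq N) : z \in l -> adj y z -> (0 < count (adj y) l)%N.
  by move=> zl xz; rewrite -has_count; apply/hasP; exists z.
have cx1 : (0 < count (adj x) l1)%N.
  by case: (l1) l1n p1 => // z l _ /= /andP[-> _].
have cx2 : (0 < count (adj x) l2)%N.
  case/lastP: (l2) l2n p2 => // l z _; rewrite rcons_path last_rcons => /andP[_ h].
  by apply: (hasc z); rewrite ?mem_rcons ?mem_head // adj_sym.
have cy1 : (0 < count (adj y) l1)%N.
  case/lastP: (l1) l1n a1 => // l z _; rewrite last_rcons => h.
  by apply: (hasy z); rewrite ?mem_rcons ?mem_head // adj_sym.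
have cy2 : (0 < count (adj y) l2)%N.
  by case: (l2) l2n p2 => // z l _ /= /andP[-> _].
have chx : (count (adj x) l1 + count (adj x) l2 <= 2)%N.
  have := chS x (mem_head _ _).
  by rewrite /= count_cat /= adj_irr (negbTE nxy).
have chy : (count (adj y) l1 + count (adj y) l2 <= 2)%N.
  have := chS y; rewrite inE mem_cat mem_head !orbT => /(_ isT).
  by rewrite /= count_cat /= adj_irr adj_sym (negbTE nxy).
have chl1 u : u \in l1 -> (adj u x + (count (adj u) l1 + adj u y) <= 2)%N.
  move=> ul; have := chS u; rewrite inE mem_cat ul !orbT => /(_ isT).
  by rewrite /= count_cat /= => h; clear -h; lia.
have chl2 u : u \in l2 -> (adj u x + (count (adj u) l2 + adj u y) <= 2)%N.
  move=> ul; have := chS u; rewrite inE mem_cat inE ul !orbT => /(_ isT).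
  by rewrite /= count_cat /= => h; clear -h; lia.
have noq (l : seq N) u : {in q & l, forall u v, ~~ adj u v} -> u \in l -> count (adj u) q = 0%N.
  move=> cl ul; apply/eqP; rewrite -leqn0 leqNgt -has_count; apply/hasPn=> v vq.
  by rewrite adj_sym; apply: cl.
have nol (l : seq N) u : {in q & l, forall u v, ~~ adj u v} -> u \in q -> count (adj u) l = 0%N.
  by move=> cl ul; apply/eqP; rewrite -leqn0 leqNgt -has_count; apply/hasPn=> v vq; apply: cl.
have pqr : path adj y (rcons (rev q) x).
  have := rev_path adj x (rcons q y).
  rewrite last_rcons belast_rcons rev_cons => ->.
  by apply: etrans pq; apply: eq_path => u v; rewrite /= adj_sym.
(* [X] uses the first arc and the reversed ear, [Y] the ear and the second arc. *)
pose X := x :: l1 ++ y :: rev q; pose Y := x :: q ++ y :: l2.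
have hX : hole X.
  apply/and4P; split.
  - have : perm_eq (x :: q ++ y :: l1) X.
      by apply/permP=> p; rewrite /= !count_cat /= count_rev; clear; lia.
    move/perm_uniq <-.
    move: uq; have -> : x :: q ++ y :: l1 ++ l2 = (x :: q ++ y :: l1) ++ l2.
      by rewrite /= -catA.
    by rewrite cat_uniq => /andP[].
  - by rewrite /= size_cat /= size_rev; case: (l1) l1n => // ? ? _; case: (q) qn => // ? ? _; rewrite /= !addnS.
  - by rewrite /X /= rcons_cat cat_path /= p1 a1.
  - apply/allP=> u; rewrite inE mem_cat inE mem_rev /= count_cat /= count_rev.
    case/or4P=> [/eqP-> | ul | /eqP-> | ul].
    + by rewrite adj_irr (negbTE nxy); move: chx cx1 cx2 cx; clear; lia.
    + by rewrite (noq l1) //; move: (chl1 u ul); clear; lia.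
    + by rewrite adj_irr adj_sym (negbTE nxy); move: chy cy1 cy2 cy; clear; lia.
    + by rewrite (nol l1) //; move: (cq u ul); rewrite /=; clear; lia.
have hY : hole Y.
  apply/and4P; split.
  - apply: subseq_uniq uq; rewrite /Y /= eqxx; apply: cat_subseq => //.
    by rewrite /= eqxx suffix_subseq.
  - by rewrite /= size_cat /=; case: (l2) l2n => // ? ? _; case: (q) qn => // ? ? _; rewrite /= !addnS.
  - by rewrite /Y /= rcons_cat cat_path /= p2 andbT -rcons_path.
  - apply/allP=> u; rewrite inE mem_cat inE /= count_cat /=.
    case/or4P=> [/eqP-> | ul | /eqP-> | ul].
    + by rewrite adj_irr (negbTE nxy); move: chx cx1 cx2 cx; clear; lia.
    + by rewrite (nol l2) //; move: (cq u ul); rewrite /=; clear; lia.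
    + by rewrite adj_irr adj_sym (negbTE nxy); move: chy cy1 cy2 cy; clear; lia.
    + by rewrite (noq l2) //; move: (chl2 u ul); clear; lia.
have oddq : odd (size q).+1.
  have := side_last pq; rewrite last_rcons size_rcons => e.
  by move: sxy; rewrite e; case: (side x); case: odd.
have sgXY : cycle_sign X * cycle_sign Y = -1.
  move: sgS; rewrite /X /Y /= !rcons_cat /= -!cat_rcons !walk_sign_cat !last_rcons.
  have := walk_sign_rev x (rcons q y).
  rewrite last_rcons belast_rcons rev_cons size_rcons -signr_odd oddq expr1 => ->.
  have := walk_sign_sqr pq; move: (walk_sign x _) (walk_sign x _) (walk_sign y _).
  move=> W1 W W2 hW h12.
  have -> : W1 * (-1 * W) * (W * W2) = - (W1 * W2) * (W * W) by ring.
  by rewrite hW h12 mulr1.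
have := cycle_sign_pm (s := X); have := cycle_sign_pm (s := Y).
have [_ _ cX _] := and4P hX; have [_ _ cY _] := and4P hY.
move=> /(_ cY) [] eY /(_ cX) [] eX; rewrite eX eY in sgXY => //.
- by exists X.
- by exists Y.
Qed.

(** Induced paths as lists in which a node is adjacent to the next node
    and to no later one, so that prefixes and suffixes are again induced. *)
Fixpoint induced s :=
  if s is x :: s' then
    (if s' is y :: t then adj x y && ~~ has (adj x) t else true) && induced s'
  else true.

Lemma induced_path x s : induced (x :: s) -> path adj x s.
Proof. by elim: s x => //= y s IH x /andP[/andP[-> _] /IH]. Qed.

Lemma induced_catl a b : induced (a ++ b) -> induced a.
Proof.
elim: a => //= x a IH /andP[h /IH ->]; rewrite andbT.
case: a h {IH} => //= y a /andP[-> /=].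
by rewrite has_cat negb_or => /andP[].
Qed.

Lemma induced_catr a b : induced (a ++ b) -> induced b.
Proof. by elim: a => //= x a IH /andP[_ /IH]. Qed.

Lemma count_eq0 u s : ~~ has (adj u) s -> count (adj u) s = 0%N.
Proof. by rewrite has_count -leqNgt leqn0 => /eqP. Qed.

Lemma induced_count_head x s : induced (x :: s) -> (count (adj x) s <= 1)%N.
Proof.
case: s => //= y s /andP[/andP[_ h] _].
by rewrite count_eq0 // addn0 leq_b1.
Qed.

Lemma induced_count_last x s :
  induced (rcons s x) -> (count (adj x) s <= 1)%N.
Proof.
elim: s => //= y s IH /andP[h /IH]; case: s h {IH} => [_|z s] /=.
  by rewrite addn0 leq_b1.
case/andP=> _; rewrite has_rcons negb_or adj_sym => /andP[/negbTE-> _].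
by rewrite add0n.
Qed.

Lemma induced_count s u : induced s -> u \in s -> (count (adj u) s <= 2)%N.
Proof.
move=> h /splitPr us; case: us h => a b h.
rewrite count_cat /= adj_irr add0n; apply: (@leq_add _ _ 1 1).
  by apply: induced_count_last; apply: (@induced_catl _ b); rewrite cat_rcons.
exact: induced_count_head (induced_catr h).
Qed.

Lemma shortest_induced x s : path adj x s ->
  (forall a u b v c, x :: s = a ++ u :: b ++ v :: c -> adj u v -> b = [::]) ->
  induced (x :: s).
Proof.
elim: s x => //= y s IH x /andP[xy ys] h; rewrite xy /=.
apply/andP; split.
  apply/hasPn=> v vs; apply/negP=> xv.
  case/splitPr: vs h => b c h.
  by have := h [::] x (y :: b) v c erefl xv.
by apply: IH => // a u b v c e; apply: (h (x :: a) u b v c); rewrite e.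
Qed.

(** The new node adds one neighbour to each of the two ends, which had at
    most one, and none to the inner nodes, which had at most two. *)
Lemma induced_closing_hole x s z y :
  induced (x :: rcons s z) -> uniq (x :: rcons s z) ->
  y \notin x :: rcons s z -> adj y x -> adj z y -> ~~ has (adj y) s ->
  hole (x :: rcons (rcons s z) y).
Proof.
move=> hi hu hy yx zy ys; apply/and4P; split.
- rewrite -rcons_cons rcons_uniq hy; exact: hu.
- by rewrite /= !size_rcons.
- by rewrite /= !rcons_path !last_rcons yx zy -rcons_path induced_path.
have c1 := induced_count_head hi.
have c2 : (count (adj z) (x :: s) <= 1)%N.
  by apply: induced_count_last; rewrite rcons_cons.
have c3 u : u \in s -> (count (adj u) (x :: rcons s z) <= 2)%N.
  by move=> us; apply: induced_count => //; rewrite inE mem_rcons inE us !orbT.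
apply/allP=> u; rewrite -rcons_cons mem_rcons inE inE mem_rcons inE -cats1 count_cat /=.
rewrite addn0 -cats1 count_cat /= addn0.
have e2 v b : count (adj v) (rcons b z) = (count (adj v) b + adj v z)%N.
  by rewrite -cats1 count_cat /= addn0.
case/or4P=> [/eqP-> | /eqP-> | /eqP-> | us].
- by rewrite yx (adj_sym y z) zy (count_eq0 ys) adj_irr.
- by rewrite adj_irr (adj_sym x y) yx; move: c1; rewrite e2; clear; lia.
- by rewrite adj_irr zy; move: c2; rewrite /=; clear; lia.
- have -> : adj u y = false by apply/negbTE; rewrite adj_sym; apply: (hasPn ys).
  by move: (c3 u us); rewrite /= e2; clear; lia.
Qed.

End SkewGraph.

(** * Adjugate of a minimal square matrix that is not unimodular *)

Definition pm1 (x : int) := (x == 1) || (x == -1).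
Definition ternary (x : int) := (x == 0) || pm1 x.

Lemma pm1_sqr x : pm1 x -> x * x = 1.
Proof. by case/orP=> /eqP->. Qed.

Lemma pm1_mul x y : pm1 x -> pm1 y -> pm1 (x * y).
Proof. by case/orP=> /eqP-> /orP[] /eqP->. Qed.

Lemma pm1_mul_l x y : pm1 (x * y) -> pm1 x.
Proof.
move=> h; have : (`|x| * `|y| = 1)%N.
  by rewrite -abszM; case/orP: h => /eqP->.
by move/eqP; rewrite muln_eq1 => /andP[/eqP hx _]; rewrite /pm1; move: hx; clear; lia.
Qed.

Lemma ternary_opp x : ternary (- x) = ternary x.
Proof. by rewrite /ternary /pm1; apply/idP/idP; lia. Qed.

Lemma ternary_pm1 x : ternary x -> x != 0 -> pm1 x.
Proof. by case/orP=> // /eqP->. Qed.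

Lemma row_free_minor (F : fieldType) m n (M : 'M[F]_(m, n)) :
  row_free M -> exists2 g : 'I_m -> 'I_n, injective g & \det (colsub g M) != 0.
Proof.
move=> fM; have fT : row_full M^T by rewrite /row_full mxrank_tr; exact: fM.
exists (fullrankfun fT); first exact: fullrankfun_inj.
have := fullrowsub_unit fT.
by rewrite unitmxE unitfE -det_tr trmx_mxsub trmxK.
Qed.

Definition ratmx m n (M : 'M[int]_(m, n)) : 'M[rat]_(m, n) :=
  map_mx (intr : int -> rat) M.

Lemma int_row_free_minor m n (M : 'M[int]_(m, n)) : row_free (ratmx M) ->
  exists2 g : 'I_m -> 'I_n, injective g & \det (colsub g M) != 0.
Proof.
case/row_free_minor=> g gi dg; exists g => //.
by move: dg; rewrite /ratmx -map_mxsub det_map_mx intr_eq0.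
Qed.

Section MinimalNonUnimodular.
Variables (k : nat) (A : 'M[int]_k).
Hypothesis minors : forall k' (f g : 'I_k' -> 'I_k), (k' < k)%N ->
  injective f -> injective g -> ternary (\det (mxsub f g A)).
Hypothesis det_big : ~~ ternary (\det A).

Lemma adj_ternary i j : ternary (\adj A i j).
Proof.
rewrite mxE /cofactor; have k0 : (k.-1 < k)%N by case: (k) i => // [[]].
have -> : row' j (col' i A) = mxsub (lift j) (lift i) A.
  by apply/matrixP=> a b; rewrite !mxE.
have := minors k0 (@lift_inj _ j) (@lift_inj _ i).
rewrite -signr_odd; case: odd; last by rewrite expr0 mul1r.
by rewrite expr1 mulN1r ternary_opp.
Qed.

Lemma mul_row_adj v v' : \sum_c A v c * \adj A c v' = \det A * (v == v')%:R.
Proof.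
have := congr1 (fun Z : 'M_k => Z v v') (mul_mx_adj A).
by rewrite !mxE => ->; rewrite mulr_natr.
Qed.

Lemma mul_adj_col c c' : \sum_v \adj A c v * A v c' = \det A * (c == c')%:R.
Proof.
have := congr1 (fun Z : 'M_k => Z c c') (mul_adj_mx A).
by rewrite !mxE => ->; rewrite mulr_natr.
Qed.

(** If row c of the adjugate vanished somewhere, its support U would be a
    proper subset of the rows.  These rows are independent, so some square
    matrix on U has determinant 1 or -1, and solving for the entries of the
    adjugate on U shows that det A divides them although they are 1 or -1. *)
Lemma adj_pm1 c v : pm1 (\adj A c v).
Proof.
apply: ternary_pm1 (adj_ternary c v) _; apply/negP=> cv0.
have d0 : \det A != 0 by apply: contraNneq det_big => ->.
(* [f] lists the rows in the support of row c of the adjugate. *)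
pose U := [set u | \adj A c u != 0].
pose f : 'I_#|U| -> 'I_k := enum_val.
have fi : injective f by apply: enum_val_inj.
have Uk : (#|U| < k)%N.
  have vU : v \notin U by rewrite inE cv0.
  have : (#|v |: U| <= #|'I_k|)%N by apply: max_card.
  by rewrite cardsU1 vU card_ord.
have : row_free (ratmx (rowsub f A)).
  have uA : ratmx A \in unitmx by rewrite unitmxE unitfE det_map_mx intr_eq0.
  apply: inj_row_free => y.
  rewrite /ratmx map_mxsub -[map_mx _ A]mul1mx -mul_rowsub_mx mulmxA => h.
  have {h} : y *m rowsub f 1%:M = 0.
    by rewrite -[LHS](mulmxK uA) h mul0mx.
  move/(congr1 (mulmx^~ (rowsub f 1%:M)^T)); rewrite mul0mx -mulmxA.
  suff -> : rowsub f 1%:M *m (rowsub f 1%:M)^T = 1%:M :> 'M[rat]_#|U| by rewrite mulmx1.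
  apply/matrixP=> a b; rewrite !mxE (bigD1 (f a)) //= !mxE eqxx mul1r.
  rewrite big1 ?addr0; first by rewrite eq_sym (inj_eq fi).
  by move=> i ia; rewrite !mxE eq_sym (negbTE ia) mul0r.
case/int_row_free_minor=> g gi dg.
have := minors Uk fi gi; have -> : mxsub f g A = colsub g (rowsub f A).
  by apply/matrixP=> a b; rewrite !mxE.
move/ternary_pm1=> /(_ dg) dpm.
pose x := rowsub (fun _ : 'I_1 => c) (\adj A).
pose M := colsub g (rowsub f A).
have e : colsub f x *m M = \row_j (\det A * (c == g j)%:R).
  apply/rowP=> j; rewrite !mxE.
  rewrite -mul_adj_col.
  rewrite [RHS](bigID (mem U)) /= [X in _ = _ + X]big1 ?addr0; last first.
    by move=> u; rewrite inE negbK => /eqP->; rewrite mul0r.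
  rewrite (big_enum_val (fun u => \adj A c u * A u (g j))).
  by apply: eq_bigr => i _; rewrite !mxE.
have := congr1 (mulmx^~ (\adj M)) e; rewrite -mulmxA mul_mx_adj mul_mx_scalar => e2.
have U0 : (0 < #|U|)%N.
  rewrite lt0n; apply/negP; rewrite cards_eq0 => /eqP U0.
  have := mul_adj_col c c.
  rewrite eqxx mulr1 big1 => [/esym/eqP|u _]; first by rewrite (negbTE d0).
  have : u \notin U by rewrite U0 inE.
  by rewrite inE negbK => /eqP->; rewrite mul0r.
have := congr1 (fun Z : 'rV_#|U| => Z 0 (Ordinal U0)) e2; rewrite !mxE.
under eq_bigr do rewrite mxE -mulrA.
rewrite -mulr_sumr => e3.
have : pm1 (\det A).
  apply: (@pm1_mul_l _ (\sum_i (c == g i)%:R * \adj M i (Ordinal U0))).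
  rewrite -e3; apply: pm1_mul dpm _; have := adj_ternary c (f (Ordinal U0)).
  have : \adj A c (f (Ordinal U0)) != 0 by have := enum_valP (Ordinal U0); rewrite inE.
  by rewrite !mxE => n0 t0; apply: ternary_pm1 t0 n0.
by move=> h; move: det_big; rewrite /ternary h orbT.
Qed.

(** Multiplying by the adjugate would give det A * z = S c0 up to sign,
    where the right side has entries 1 and -1. *)
Lemma no_integral_inverse_row (z : 'I_k -> int) c0 :
  pm1 (\sum_v z v * A v c0) ->
  (forall c, c != c0 -> \sum_v z v * A v c = 0) -> False.
Proof.
move=> he hz.
have : \sum_c (\sum_v z v * A v c) * \adj A c c0 = z c0 * \det A.
  under eq_bigr do rewrite mulr_suml.
  rewrite exchange_big /= (bigD1 c0) //= [X in _ + X]big1 ?addr0.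
    under eq_bigr do rewrite -mulrA.
    by rewrite -mulr_sumr mul_row_adj eqxx mulr1.
  move=> v vc0; under eq_bigr do rewrite -mulrA.
  by rewrite -mulr_sumr mul_row_adj (negbTE vc0) !mulr0.
rewrite (bigD1 c0) //= [X in _ + X]big1 ?addr0 => [h|c cc]; last by rewrite (hz c cc) mul0r.
move: det_big; rewrite /ternary; suff -> : pm1 (\det A) by rewrite orbT.
apply: (@pm1_mul_l _ (z c0)); rewrite mulrC -h.
exact: pm1_mul he (adj_pm1 _ _).
Qed.

End MinimalNonUnimodular.

(** * Sizes, terms and branches *)

(** Turns statements about a sum of signs into arithmetic on the number of
    its terms and the number of its negative terms. *)
Lemma pm1_sum (I : finType) (P : {set I}) (t : I -> int) :
  {in P, forall i, pm1 (t i)} ->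
  \sum_(i in P) t i = #|P|%:Z - 2 * #|[set i in P | t i == (-1)%R]|%:Z.
Proof.
move=> ht.
have -> : \sum_(i in P) t i = \sum_(i in P) (1 - 2 * (t i == -1)%:Z).
  by apply: eq_bigr => i iP; case/orP: (ht i iP) => /eqP->.
rewrite sumrB -mulr_sumr; congr (_ - 2 * _).
  by rewrite sumr_const; lia.
rewrite -sum1_card (big_morph _ PoszD (erefl _)).
rewrite big_mkcond [RHS]big_mkcond /=; apply: eq_bigr => i _.
by rewrite inE; case: (i \in P) => //=; case: (t i == -1).
Qed.

Section Numeric.
Variables (k : nat) (A : 'M[int]_k).
Hypothesis entries : forall v c, ternary (A v c).
Hypothesis minors : forall k' (f g : 'I_k' -> 'I_k), (k' < k)%N ->
  injective f -> injective g -> ternary (\det (mxsub f g A)).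
Hypothesis det_big : ~~ ternary (\det A).
Definition colsupp (c : 'I_k) := [set v | A v c != 0].
Local Notation sz c := #|colsupp c|.
Hypothesis big_disjoint : forall c c' v, c != c' -> (4 <= sz c)%N ->
  (4 <= sz c')%N -> A v c != 0 -> A v c' = 0.
Local Notation S := (\adj A).

Let S_pm1 c v : pm1 (S c v) := adj_pm1 minors det_big c v.

Lemma entry_pm1 v c : A v c != 0 -> pm1 (A v c).
Proof. exact: ternary_pm1 (entries v c). Qed.

Lemma order_gt1 : (1 < k)%N.
Proof.
have := det_big; have := entries; clear.
case: k A => [|[|n]] // B hB; first by rewrite det_mx00.
by rewrite det_mx11 hB.
Qed.

Lemma supp_sum (z : 'I_k -> int) c :
  \sum_v z v * A v c = \sum_(v in colsupp c) z v * A v c.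
Proof.
rewrite [RHS]big_mkcond /=; apply: eq_bigr => v _; rewrite inE.
by case: eqP => //= ->; rewrite mulr0.
Qed.

(** Another row of the adjugate weights the column by signs with sum 0. *)
Lemma col_even c : ~~ odd (sz c).
Proof.
have [c' cc'] : exists c', c' != c.
  have k1 := order_gt1; pose a := Ordinal k1; pose b := Ordinal (ltnW k1).
  case: (a =P c) => [<-|/eqP]; last by exists a.
  by exists b.
have := mul_adj_col A c' c; rewrite (negbTE cc') mulr0 supp_sum pm1_sum.
  by move: (sz c) #|_| => a b; clear; lia.
by move=> v; rewrite inE => /entry_pm1; apply: pm1_mul.
Qed.

Lemma col_gt0 c : (0 < sz c)%N.
Proof.
rewrite lt0n; apply/negP; rewrite cards_eq0 => /eqP e.
have := mul_adj_col A c c; rewrite eqxx mulr1 supp_sum e big_set0 => d0.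
by move: det_big; rewrite -d0.
Qed.

Lemma col_small c : ~~ (4 <= sz c)%N -> sz c = 2%N.
Proof. by have := col_even c; have := col_gt0 c; clear; lia. Qed.

(** Columns of size at least 4 are disjoint, and k of them would need 4k
    rows. *)
Lemma exists_small : exists c, sz c = 2%N.
Proof.
have [/existsP[c]|h] := boolP [exists c, ~~ (4 <= sz c)%N].
  by move/col_small; exists c.
have {}h c : (4 <= sz c)%N.
  by move: h; rewrite negb_exists => /forallP/(_ c); rewrite negbK.
have k1 := order_gt1.
have : (\sum_(c < k) 4%N <= \sum_(v < k) 1%N)%N.
  apply: (@leq_trans (\sum_(c < k) sz c)); first by apply: leq_sum => c _.
  under eq_bigr do rewrite -sum1_card big_mkcond /=.
  rewrite exchange_big /=; apply: leq_sum => v _.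
  rewrite -big_mkcond /=.
  have [/existsP[c vc]|no] := boolP [exists c, v \in colsupp c].
    rewrite (big_pred1 c) // => c'; apply/idP/eqP => [vc'|-> //].
    apply/eqP; apply: contraLR vc' => cc'; rewrite inE negbK; apply/eqP.
    by move: vc; rewrite inE; apply: big_disjoint; rewrite // eq_sym.
  rewrite big_pred0 // => c; apply/negbTE; move: no.
  by rewrite negb_exists => /forallP/(_ c).
by rewrite !sum_nat_const card_ord; move: k1; clear; lia.
Qed.

(** The expansion of the determinant along a column of size 2 has two
    terms equal to 1 or -1. *)
Lemma det_pm2 : exists2 s, pm1 s & \det A = 2 * s.
Proof.
have [c e] := exists_small.
have := mul_adj_col A c c; rewrite eqxx mulr1 supp_sum pm1_sum; last first.
  by move=> v; rewrite inE => /entry_pm1; apply: pm1_mul.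
rewrite e => h; exists (1 - #|[set i in colsupp c | (S c i * A i c == -1)%R]|%:Z); last first.
  by rewrite -h; ring.
move: det_big; rewrite /ternary /pm1 -h.
have : (#|[set i in colsupp c | (S c i * A i c == -1)%R]| <= 2)%N.
  by rewrite -e; apply: subset_leq_card; apply/subsetP=> v; rewrite inE => /andP[].
by move: #|_| => m; clear; lia.
Qed.

(** The two terms add up to 2s and are signs. *)
Lemma small_entry s c v : \det A = 2 * s -> pm1 s -> sz c = 2%N -> A v c != 0 ->
  S c v * A v c = s.
Proof.
move=> ds ps e vc.
have := mul_adj_col A c c; rewrite eqxx mulr1 supp_sum ds => h.
have : \sum_(v in colsupp c) s * (S c v * A v c) = 2.
  by rewrite -mulr_sumr h mulrCA pm1_sqr // mulr1.
have hp : {in colsupp c, forall v, pm1 (s * (S c v * A v c))}.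
  by move=> u; rewrite inE => /entry_pm1 hu; do 2![apply: pm1_mul => //].
rewrite pm1_sum // e => h2; have /eqP : #|[set i in colsupp c | (s * (S c i * A i c) == -1)%R]| = 0%N.
  by move: h2; move: #|_| => m; clear; lia.
rewrite cards_eq0 => /eqP/setP/(_ v); rewrite !inE vc /= => h3.
have := hp v; rewrite inE vc /pm1 h3 orbF => /(_ isT)/eqP h4.
by rewrite -[LHS]mul1r -(pm1_sqr ps) -mulrA h4 mulr1.
Qed.

(** Four or more signs add up to 2s, so one of them is opposite to s. *)
Lemma big_col_center s h : \det A = 2 * s -> pm1 s -> (4 <= sz h)%N ->
  exists2 r, A r h != 0 & S h r * A r h = - s.
Proof.
move=> ds ps e.
have := mul_adj_col A h h; rewrite eqxx mulr1 supp_sum ds => hh.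
have : \sum_(v in colsupp h) s * (S h v * A v h) = 2.
  by rewrite -mulr_sumr hh mulrCA pm1_sqr // mulr1.
have hp : {in colsupp h, forall v, pm1 (s * (S h v * A v h))}.
  by move=> u; rewrite inE => /entry_pm1 hu; do 2![apply: pm1_mul => //].
rewrite pm1_sum // => h2.
have : (0 < #|[set i in colsupp h | ((s * (S h i * A i h)) == -1)%R]|)%N.
  by move: h2 e; move: #|_| #|_| => m m'; clear; lia.
rewrite card_gt0 => /set0Pn[r]; rewrite !inE => /andP[rh /eqP h3].
by exists r => //; rewrite -[LHS]mul1r -(pm1_sqr ps) -mulrA h3 mulrN1.
Qed.

Section Center.
Variables (s : int) (h r : 'I_k).
Hypotheses (det_s : \det A = 2 * s) (s_pm : pm1 s) (h_big : (4 <= sz h)%N).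
Hypotheses (rh : A r h != 0) (rh_s : S h r * A r h = - s).

Definition spokes := [set c | (c != h) && (A r c != 0)].

Lemma spoke_small f : f \in spokes -> sz f = 2%N.
Proof.
rewrite inE => /andP[fh rf]; apply: col_small; apply/negP => fb.
by move: rf; rewrite (big_disjoint (c := h)) ?eqxx // eq_sym.
Qed.

Lemma spoke_sum v : \sum_c A r c * S c v =
  A r h * S h v + \sum_(f in spokes) A r f * S f v.
Proof.
rewrite (bigD1 h) //=; congr (_ + _).
rewrite big_mkcond [RHS]big_mkcond; apply: eq_bigr => c _; rewrite inE.
by case: (c != h) => //=; case: eqP => //= ->; rewrite mul0r.
Qed.

(** Expanding along row r: column h contributes -s and every other column
    through r has size 2 and contributes s, for a total of 2s. *)
Lemma card_spokes : #|spokes| = 3%N.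
Proof.
have := mul_row_adj A r r; rewrite eqxx mulr1 spoke_sum mulrC rh_s det_s.
rewrite (eq_bigr (fun=> s)); last first.
  move=> f fs; rewrite mulrC; apply: small_entry => //; first exact: spoke_small.
  by move: fs; rewrite inE => /andP[].
rewrite sumr_const -mulr_natr; case/orP: s_pm => /eqP->; move: #|_| => m; clear; lia.
Qed.

(** In the relation (A S) r j = 0 the terms of h and of the three spokes are
    signs with sum zero, so for j different from r precisely one spoke has the
    same term as h; the branches partition the rows other than r. *)
Definition branch f := [set j | (j != r) && (A r h * S h j == A r f * S f j)].

(** Three equal signs and a fourth one do not add up to zero. *)
Lemma branch_disjoint f f' j : f \in spokes -> f' \in spokes -> f != f' ->
  j \in branch f -> j \in branch f' -> False.
Proof.
move=> fs fs' ff'; rewrite !inE => /andP[jr /eqP e] /andP[_ /eqP e'].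
have := mul_row_adj A r j; rewrite eq_sym (negbTE jr) mulr0 spoke_sum.
rewrite (big_setD1 f) //= (big_setD1 f') /=; last first.
  by rewrite in_setD1 eq_sym ff'.
have hp c : c \in spokes -> pm1 (A r c * S c j).
  by rewrite inE => /andP[_ rc]; apply: pm1_mul => //; apply: entry_pm1.
rewrite pm1_sum => [|c]; last by rewrite !in_setD1 => /and3P[_ _ /hp].
set R := (spokes :\ f) :\ f'.
have cR : #|R| = 1%N.
  have := cardsD1 f spokes; have := cardsD1 f' (spokes :\ f).
  rewrite in_setD1 (eq_sym f') ff' fs fs' card_spokes -/R; move: #|R| #|_| => a b; clear; lia.
have : (#|[set i in R | (A r i * S i j == -1)%R]| <= #|R|)%N.
  by apply: subset_leq_card; apply/subsetP=> c; rewrite inE => /andP[].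
rewrite cR -e -e'; have := hp f fs; rewrite -e; move: (A r h * _) #|_| => x m.
by rewrite /pm1; clear; lia.
Qed.

(** Up to the signs A r h and A r f, half the sum of the rows h and f of the
    adjugate is supported on the branch of f, where it is row h; its product
    with A is zero outside the columns h and f. *)
Lemma branch_balance f c : f \in spokes ->
  2 * A r h * \sum_(j in branch f) S h j * A j c
  = \det A * (A r h * (h == c)%:R + A r f * (f == c)%:R).
Proof.
move=> fs; have [fh rf] : f != h /\ A r f != 0 by apply/andP; move: fs; rewrite inE.
rewrite mulrDr ![\det A * (_ * _)]mulrCA -!mul_adj_col !mulr_sumr -big_split /=.
rewrite big_mkcond /=; apply: eq_bigr => j _; rewrite !mulrA -mulrDl inE.
case: eqP => [->|/eqP jr] /=.
  rewrite [A r h * _]mulrC rh_s mulrC [A r f * _]mulrC (@small_entry s) //.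
    by rewrite addNr mulr0.
  exact: spoke_small.
have := pm1_mul (entry_pm1 rh) (S_pm1 h j).
have := pm1_mul (entry_pm1 rf) (S_pm1 f j).
case: eqP => [<-|]; first by move=> *; ring.
move: (A r h * _) (A r f * _) => x y xy hx hy.
have -> : x + y = 0 by move: xy hx hy; rewrite /pm1; clear; lia.
by rewrite mul0r.
Qed.

Lemma branch_balance0 f c : f \in spokes -> c != h -> c != f ->
  \sum_(j in branch f) S h j * A j c = 0.
Proof.
move=> fs ch cf; have := branch_balance c fs.
rewrite (eq_sym h) (eq_sym f) (negbTE ch) (negbTE cf) !mulr0n !mulr0.
by move/eqP; rewrite !mulf_eq0 (negbTE rh) /= => /eqP.
Qed.

Lemma branch_balance1 f : f \in spokes ->
  pm1 (\sum_(j in branch f) S h j * A j f).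
Proof.
move=> fs; have [fh rf] : f != h /\ A r f != 0 by apply/andP; move: fs; rewrite inE.
have := branch_balance f fs.
rewrite eqxx (eq_sym h) (negbTE fh) mulr0 add0r mulr1 det_s -!mulrA.
move/mulfI => /(_ isT) e; apply: (@pm1_mul_l _ (A r h)); rewrite mulrC e.
by apply: pm1_mul => //; apply: entry_pm1.
Qed.

End Center.
End Numeric.

(** * Routes of least weight in the row-column graph *)

Lemma not_uniq_split (T : eqType) (s : seq T) : ~~ uniq s ->
  exists a u b c, s = a ++ u :: b ++ u :: c.
Proof.
elim: s => //= x s IH; rewrite negb_and negbK.
have [/splitPr[b c] _|_ /IH[a [u [b [c ->]]]]] := boolP (x \in s).
  by exists [::], x, b, c.
by exists (x :: a), u, b, c.
Qed.

Lemma split_first (T : eqType) (p : pred T) s : has p s ->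
  exists a u b, [/\ s = a ++ u :: b, p u & ~~ has p a].
Proof.
elim: s => //= x s IH; have [px _|px /IH[a [u [b [-> pu pa]]]]] := boolP (p x).
  by exists [::], x, s.
by exists (x :: a), u, b; rewrite /= negb_or px.
Qed.

Lemma split_last (T : eqType) (p : pred T) s : has p s ->
  exists a u b, [/\ s = a ++ u :: b, p u & ~~ has p b].
Proof.
rewrite -has_rev => /split_first[a [u [b [e pu pa]]]].
exists (rev b), u, (rev a); rewrite has_rev; split=> //.
by rewrite -[s]revK e rev_cat rev_cons cat_rcons.
Qed.

Lemma count_gt1_split (T : eqType) (p : pred T) s : (1 < count p s)%N ->
  exists a u b v c, [/\ s = a ++ u :: b ++ v :: c, p u & p v].
Proof.
move=> c1; have /split_first[a [u [t [e pu pa]]]] : has p s.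
  by rewrite has_count (ltn_trans _ c1).
move: c1; rewrite e count_cat /= pu; move: pa; rewrite has_count -leqNgt leqn0 => /eqP->.
rewrite ltnS -has_count => /split_first[b [v [c [-> pv _]]]].
by exists a, u, b, v, c.
Qed.

Lemma uniq_count_le1 (T : eqType) (p : pred T) s x : uniq s ->
  {in s, forall y, p y -> y = x} -> (count p s <= 1)%N.
Proof.
move=> us h; rewrite leqNgt; apply/negP=> /count_gt1_split[a [u [b [v [c [e pu pv]]]]]].
have eu : u = x by apply: h => //; rewrite e mem_cat mem_head orbT.
have ev : v = x by apply: h => //; rewrite e mem_cat inE mem_cat mem_head !orbT.
move: us; rewrite e eu ev cat_uniq /= mem_cat mem_head orbT.
by rewrite !andbF.
Qed.

Section Bipartite.
Variables (k : nat) (A : 'M[int]_k).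
Hypothesis entries : forall v c, ternary (A v c).

Definition node := ('I_k + 'I_k)%type.

Definition entry_weight (x y : node) : int :=
  match x, y with
  | inl v, inr c => - A v c
  | inr c, inl v => A v c
  | _, _ => 0
  end.

Definition is_row (x : node) := if x is inl _ then true else false.

Lemma entry_weight_skew x y : entry_weight y x = - entry_weight x y.
Proof. by case: x y => [v|c] [v'|c'] //=; rewrite ?opprK ?oppr0. Qed.

Lemma entry_weight_unit x y : entry_weight x y != 0 -> entry_weight x y * entry_weight x y = 1.
Proof.
case: x y => [v|c] [v'|c'] //=; rewrite ?oppr_eq0 ?mulrNN => /(ternary_pm1 (entries _ _));
exact: pm1_sqr.
Qed.

Lemma entry_weight_side x y : entry_weight x y != 0 -> is_row y = ~~ is_row x.
Proof. by case: x y => [v|c] [v'|c']. Qed.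

Local Notation adjA := (adj entry_weight).

Lemma adj_rc v c : adjA (inl v) (inr c) = (A v c != 0).
Proof. by rewrite /adj /= oppr_eq0. Qed.

Lemma adj_cr v c : adjA (inr c) (inl v) = (A v c != 0).
Proof. by []. Qed.

Lemma adjC x y : adjA x y = adjA y x.
Proof. exact: (adj_sym entry_weight_skew). Qed.

Local Notation sz c := #|colsupp A c|.

Definition allowed (X : {set 'I_k}) (h : 'I_k) (x : node) :=
  match x with inl v => v \in X | inr c => c != h end.

(** A column of size at least 4 is lighter than a column of size 2, so that a
    lightest route passes through every large column containing two of its
    rows; see [big_touch]. *)
Definition node_weight (x : node) : nat :=
  if x is inr c then (if (4 <= sz c)%N then 1 else 2)%N else 1%N.
Definition weight (L : seq node) := sumn (map node_weight L).

Lemma weight_cat L1 L2 : weight (L1 ++ L2) = (weight L1 + weight L2)%N.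
Proof. by rewrite /weight map_cat sumn_cat. Qed.

Lemma node_weight_gt0 x : (0 < node_weight x)%N.
Proof. by case: x => //= c; case: ifP. Qed.

Lemma size_weight L : (size L <= weight L)%N.
Proof.
elim: L => //= x L IH; rewrite /weight /= -add1n.
by apply: leq_add => //; apply: node_weight_gt0.
Qed.

Definition route X h r (L : seq node) :=
  [&& L != [::], path adjA (inl r) L, all (allowed X h) L
    & adjA (last (inl r) L) (inr h)].

Definition light_route X h r L :=
  route X h r L /\ forall L', route X h r L' -> (weight L <= weight L')%N.

Lemma light_route_exists X h r L : route X h r L -> exists L', light_route X h r L'.
Proof.
move=> hL.
pose Q n := [exists m : 'I_n.+1, [exists t : m.-tuple node,
  route X h r t && (weight t == n)]].
have QP L' : route X h r L' -> Q (weight L').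
  move=> hL'; have s : (size L' < (weight L').+1)%N by rewrite ltnS size_weight.
  apply/existsP; exists (Ordinal s); apply/existsP; exists (in_tuple L').
  by rewrite /= hL' eqxx.
have exQ : exists n, Q n by exists (weight L); apply: QP.
have [n /existsP[m /existsP[t /andP[ht /eqP e]]] hn] := ex_minnP exQ.
exists t; split=> // L' /QP; rewrite e; exact: hn.
Qed.

Section Sector.
Variables (X : {set 'I_k}) (h r : 'I_k) (L : seq node).
Hypotheses (rX : r \notin X) (rh : A r h != 0) (light : light_route X h r L).

Lemma route_L : route X h r L. Proof. by case: light. Qed.

Lemma light_shortcut a b c : L = a ++ b ++ c -> route X h r (a ++ c) -> b = [::].
Proof.
move=> e /(proj2 light); rewrite e !weight_cat leq_add2l.
rewrite -[X in (_ <= X)%N]add0n leq_add2r leqn0 => w0.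
by apply/eqP; rewrite -size_eq0 -leqn0 (leq_trans (size_weight b)) // (eqP w0).
Qed.

(** Otherwise jumping from u to v would give a lighter route. *)
Lemma light_chord a u b v c : inl r :: L = a ++ u :: b ++ v :: c ->
  adjA u v -> b = [::].
Proof.
have /and4P[_ pL aL lL] := route_L.
case: a => [|x a] [].
  move=> <- e uv.
  apply: (@light_shortcut [::] b (v :: c)) => //.
  rewrite cat0s; apply/and4P; split=> //; move: pL aL lL; rewrite e.
  - by rewrite /= cat_path /= uv => /and3P[].
  - by rewrite all_cat => _ /andP[].
  - by rewrite last_cat.
move=> _ e uv.
apply: (@light_shortcut (rcons a u) b (v :: c)); first by rewrite cat_rcons.
apply/and4P; split=> //; first by case: (a).
all: move: pL aL lL; rewrite e cat_rcons.
- by rewrite !cat_path /= cat_path /= uv => /and5P[-> -> _ _ ->].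
- by rewrite !all_cat /= ?all_cat /= => _ /and5P[-> -> _ -> ->].
- by rewrite !last_cat /= last_cat.
Qed.

Lemma light_induced : induced entry_weight (inl r :: L).
Proof.
have /and4P[_ pL _ _] := route_L.
by apply: shortest_induced pL _ => a u b v c; apply: light_chord.
Qed.

Lemma light_uniq : uniq (inl r :: L).
Proof.
have /and4P[_ pL aL lL] := route_L.
rewrite /=; apply/andP; split; first by apply: contra rX => /(allP aL).
apply/negPn/negP=> /not_uniq_split[a [u [b [c e]]]].
suff : u :: b = [::] by [].
apply: (@light_shortcut a (u :: b) (u :: c)) => //.
apply/and4P; split=> //; first by case: (a).
all: move: pL aL lL; rewrite e.
- by rewrite !cat_path /= cat_path /= => /and5P[-> -> _ _ ->].
- by rewrite !all_cat /= ?all_cat /= => _ /and5P[-> -> _ _ ->].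
- by rewrite !last_cat /= last_cat.
Qed.

Lemma light_end a u c : L = a ++ u :: c -> adjA u (inr h) -> c = [::].
Proof.
have /and4P[_ pL aL lL] := route_L => e uh.
apply: (@light_shortcut (rcons a u) c [::]); first by rewrite cats0 cat_rcons.
apply/and4P; split=> //; first by case: (a).
all: move: pL aL lL; rewrite e cats0 -cat_rcons.
- by rewrite cat_path => /andP[].
- by rewrite all_cat => _ /andP[].
- by rewrite last_rcons.
Qed.

(** Going from z to z' through y gives another route. *)
Lemma light_bypass a z b z' c y : L = a ++ z :: b ++ z' :: c -> y != h ->
  adjA z (inr y) -> adjA (inr y) z' -> (weight b <= node_weight (inr y))%N.
Proof.
have /and4P[_ pL aL lL] := route_L => e yh zy yz.
have : route X h r (a ++ z :: inr y :: z' :: c).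
{ apply/and4P; split=> //; first by case: (a).
  all: move: pL aL lL; rewrite e.
  - by rewrite !cat_path /= cat_path /= zy yz => /and5P[-> -> _ _ ->].
  - by rewrite !all_cat /= ?all_cat /= yh => _ /and5P[-> -> _ -> ->].
  - by rewrite !last_cat /= last_cat. }
move/(proj2 light); rewrite e !weight_cat leq_add2l /weight /= map_cat sumn_cat /=.
by clear; lia.
Qed.

Lemma light_last : exists L0 z, [/\ L = rcons L0 (inl z), A z h != 0 &
  ~~ has (adjA (inr h)) L0].
Proof.
have /and4P[n0 pL _ lL] := route_L.
case/lastP: L n0 lL light_end => // L0 [z|c] _; rewrite last_rcons //.
rewrite adj_rc => zh he.
exists L0, z; split=> //; apply/hasPn => u /splitPr us; case: us he => a b he.
apply/negP; rewrite adjC => /(he a u (rcons b (inl z))).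
by rewrite rcons_cat => /(_ erefl); case: (b).
Qed.

Lemma sector_hole : hole entry_weight (inl r :: rcons L (inr h)).
Proof.
have /and4P[_ _ aL _] := route_L.
have [L0 [z [e zh L0h]]] := light_last.
have := light_induced; have := light_uniq; rewrite e => hu hi.
apply: (induced_closing_hole entry_weight_skew entry_weight_side hi hu) => //.
- rewrite inE /= -e; apply/negP=> /(allP aL); rewrite /= eqxx; exact: notF.
- by rewrite adj_rc.
Qed.

Lemma col_next c : inr c \in L -> exists2 v, inl v \in L & A v c != 0.
Proof.
have /and4P[_ pL _ _] := route_L; have [L0 [z [e zh _]]] := light_last.
move=> cL; case/splitPr: cL pL e => a [|[v|c'] b].
- by move=> _ /(congr1 (last (inr h))); rewrite last_cat last_rcons.
- rewrite cat_path /= => /and3P[_ _ /andP[cv _]] _; exists v => //.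
  by rewrite mem_cat !inE eqxx !orbT.
- by rewrite cat_path /= !andbF.
Qed.

Lemma row_in_X v : inl v \in L -> v \in X.
Proof. by have /and4P[_ _ aL _] := route_L; move/(allP aL). Qed.

Lemma col_neq_h c : inr c \in L -> c != h.
Proof. by have /and4P[_ _ aL _] := route_L; move/(allP aL). Qed.

Hypothesis big_disjoint : forall c c' v, c != c' -> (4 <= sz c)%N ->
  (4 <= sz c')%N -> A v c != 0 -> A v c' = 0.

(** Two rows of a large column y on the route are joined on it by a segment
    no heavier than y, hence by a single large column.  Large columns are
    disjoint, so that column is y. *)
Lemma big_touch y : (4 <= sz y)%N -> y != h -> inr y \notin L ->
  (count (adjA (inr y)) L <= 1)%N.
Proof.
have /and4P[_ pL _ _] := route_L.
move=> ybig yh yL; rewrite leqNgt; apply/negP.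
move=> /count_gt1_split[a [z [b [z' [c [e yz yz']]]]]].
have [v ez] : exists v, z = inl v by case: (z) yz => // v _; exists v.
have [v' ez'] : exists v, z' = inl v by case: (z') yz' => // w _; exists w.
have := light_bypass e yh; rewrite adjC => /(_ yz yz') /=; rewrite ybig => wb.
have := size_weight b; move: pL e wb; rewrite ez ez'.
case: b => [|x [|? ?]] pL e wb.
- by move: pL; rewrite e cat_path /= !andbF.
- move=> _; case: x e wb => [w|x] e.
    by move: pL; rewrite e cat_path /= !andbF.
  rewrite /weight /=; case: ifP => // xbig _.
  have xL : inr x \in L by rewrite e mem_cat !inE eqxx !orbT.
  have xy : x != y by apply: contraNneq yL => <-.
  move: pL; rewrite e cat_path /= adj_rc => /and3P[_ _ /andP[vx _]].
  move: yz; rewrite ez adj_cr.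
  by rewrite (big_disjoint xy xbig ybig vx) eqxx.
- by move=> h2; have := leq_trans h2 wb.
Qed.

End Sector.
End Bipartite.

(** * Two routes are separated or create an odd cycle *)

Lemma count_le1_eq (T : eqType) (p : pred T) s x y : (count p s <= 1)%N ->
  x \in s -> y \in s -> p x -> p y -> x = y.
Proof.
move=> c1 xs; case/splitPr: xs c1 => a b; rewrite count_cat /= => c1 ys px py.
apply/eqP; apply: contraLR c1 => xy; rewrite px -ltnNge add1n addnS ltnS -count_cat.
rewrite -has_count; apply/hasP; exists y => //.
by move: ys; rewrite !mem_cat inE eq_sym (negbTE xy).
Qed.

Section Crossing.
Variables (k : nat) (A : 'M[int]_k).
Hypothesis entries : forall v c, ternary (A v c).
Local Notation sz c := #|colsupp A c|.
Local Notation adjA := (adj (entry_weight A)).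
Hypothesis big_disjoint : forall c c' v, c != c' -> (4 <= sz c)%N ->
  (4 <= sz c')%N -> A v c != 0 -> A v c' = 0.
Hypothesis no_odd_hole : forall s, hole (entry_weight A) s -> cycle_sign (entry_weight A) s != -1.

Let bwk := @entry_weight_skew k A.
Let bwu := entry_weight_unit entries.
Let bws := @entry_weight_side k A.

Lemma hole_even s : hole (entry_weight A) s -> cycle_sign (entry_weight A) s = 1.
Proof.
move=> hs; have /and4P[_ _ cs _] := hs.
by case: (cycle_sign_pm bwu cs) => // e; have := no_odd_hole hs; rewrite e eqxx.
Qed.

Variables (h r : 'I_k) (X1 X2 : {set 'I_k}) (L1 L2 : seq (node k)).
Hypotheses (rh : A r h != 0) (h_big : (4 <= sz h)%N).
Hypotheses (rX1 : r \notin X1) (rX2 : r \notin X2).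
Hypothesis X12 : forall v, v \in X1 -> v \in X2 -> False.
Hypotheses (light1 : light_route A X1 h r L1) (light2 : light_route A X2 h r L2).
Hypothesis spoke : forall c, c != h -> A r c != 0 -> ~~ (4 <= sz c)%N.
Hypothesis cross_big : forall c v v', c != h -> v \in X1 -> v' \in X2 ->
  A v c != 0 -> A v' c != 0 -> (4 <= sz c)%N.

(** Follow the second route from r towards h.  It starts at a row of the
    even cycle C formed by r, the first route and h, and ends at a column of C.
    Stop at the first row u' that lies in a column y of C, and go back from
    there to the last column g that contains a row x of C.  The part from g to u'
    is an ear of C from x to y.  The columns involved are large, except g when
    it contains r, and large columns are disjoint; therefore x and y are unique,
    and they are adjacent only if x is r and y is h, which means that the whole
    second route is separated from C. *)
Lemma light_routes_clean u v : u \in L1 -> v \in L2 -> ~~ adjA u v.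
Proof.
move=> u0L v0L; apply/negP=> uv0.
have bigE c c' w : (4 <= sz c)%N -> (4 <= sz c')%N -> A w c != 0 -> A w c' != 0 -> c = c'.
  move=> cb cb' wc; apply: contraNeq => cc'.
  by rewrite (big_disjoint cc' cb cb' wc).
have [p1 p2] := (route_L light1, route_L light2).
have /and4P[_ pL1 _ _] := p1; have /and4P[n2 pL2 _ lL2] := p2.
have i2 := light_induced light2; have u2 := light_uniq rX2 light2.
have u1 := light_uniq rX1 light1.
have S1 := sector_hole rX1 rh light1.
have nr := col_next light1.
have nr2 := col_next light2.
pose B x := is_row x && has (adjA x) (rcons L1 (inr h)).
pose G x := ~~ is_row x && has (adjA x) (inl r :: L1).
have [L20 [z2 [eL2 z2h _]]] := light_last light2.
have : has B L2.
  rewrite eL2 has_rcons /B /=; apply/orP; left.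
  by rewrite has_rcons adj_rc z2h.
(* The ear ends at the first row of the second route in a column of the cycle. *)
case/split_first=> a [u1' [b [e2 Bu Ba]]].
have [u' eu] : exists u', u1' = inl u' by case: (u1') Bu => // w _; exists w.
rewrite {}eu {u1'} in e2 Bu.
have u'X2 : u' \in X2 by apply: (row_in_X light2); rewrite e2 mem_cat mem_head orbT.
(* A column of [a] on the first route would be large, so the row before it on
   the second route would already be a stopping point. *)
have Ca c : inr c \in a -> inr c \notin L1 /\ c != h.
  move=> ca; have cL2 : inr c \in L2 by rewrite e2 mem_cat ca.
  have ch : c != h by apply: (col_neq_h light2).
  split=> //; apply/negP=> cL1.
  have [v1 v1L v1c] := nr c cL1; have [v2 v2L v2c] := nr2 c cL2.
  have cbig := cross_big ch (row_in_X light1 v1L) (row_in_X light2 v2L) v1c v2c.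
  case/splitPr: ca e2 Ba => a1 a2 e2 Ba.
  move: pL2; rewrite e2 -catA cat_path /= => /and3P[_ h1 _].
  case/lastP: a1 e2 Ba h1 => [|a1 x] _ Ba.
    by rewrite /= adj_rc => rc; have := spoke ch rc; rewrite cbig.
  rewrite last_rcons => xc; move/hasPn/(_ x): Ba.
  rewrite mem_cat mem_rcons mem_head => /(_ isT)/negP; apply.
  case: x xc => // w wc; rewrite /B /=; apply/hasP; exists (inr c) => //.
  by rewrite mem_rcons inE cL1 orbT.
have aG : has G a.
  case: a e2 {Ba Ca} => [|y a] e2; first by move: pL2; rewrite e2.
  move: pL2; rewrite e2 /= => /andP[ry _]; case: y ry {e2} => // c rc.
  by rewrite /G /= adj_cr -adj_rc rc.
(* It starts at the last earlier column containing a row of the cycle. *)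
case/split_last: aG => a1 [g [a2 [ea Gg Ga2]]].
have [cg eg] : exists c, g = inr c by case: (g) Gg => // w _; exists w.
rewrite {}eg {g} in ea Gg.
have cga : inr cg \in a by rewrite ea mem_cat mem_head orbT.
have [cgL1 cgh] := Ca cg cga.
have cgL2 : inr cg \in L2 by rewrite e2 mem_cat cga.
have [v2 /(row_in_X light2) v2X v2c] := nr2 cg cgL2.
have /hasP[x xS xg] : has (adjA (inr cg)) (inl r :: L1) by case/andP: Gg.
have [xv ex] : exists v, x = inl v by case: (x) xg => // w _; exists w.
rewrite {}ex {x} adj_cr in xS xg.
have xuniq x' : inl x' \in inl r :: L1 -> A x' cg != 0 -> x' = xv.
  have [rc|rc] := boolP (A r cg != 0).
    suff H w : inl w \in inl r :: L1 -> A w cg != 0 -> w = r.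
      by move=> h1 h2; rewrite (H _ h1 h2) (H _ xS xg).
    rewrite inE => /orP[/eqP[] // | /(row_in_X light1) wX] wc.
    by have := cross_big cgh wX v2X wc v2c; rewrite (negbTE (spoke cgh rc)).
  have H w : inl w \in inl r :: L1 -> A w cg != 0 -> inl w \in L1.
    by rewrite inE => /orP[/eqP[->] h1|//]; rewrite h1 in rc.
  move=> h1 h2; have := H _ h1 h2; have := H _ xS xg => hx hx'.
  have cbig := cross_big cgh (row_in_X light1 hx) v2X xg v2c.
  have := big_touch light1 big_disjoint cbig cgh cgL1.
  by move=> /count_le1_eq /(_ hx' hx) /(_ h2 xg) [].
have /hasP[y yS uy] : has (adjA (inl u')) (rcons L1 (inr h)) by case/andP: Bu.
have [yc ey] : exists c, y = inr c by case: (y) uy => // w _; exists w.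
rewrite {}ey {y} adj_rc in yS uy.
have big_y c : inr c \in rcons L1 (inr h) -> A u' c != 0 -> (4 <= sz c)%N.
  rewrite mem_rcons inE => /orP[/eqP[->] //|cL1 uc].
  have [v1 /(row_in_X light1) v1X v1c] := nr c cL1.
  exact: cross_big (col_neq_h light1 cL1) v1X u'X2 v1c uc.
have yuniq c : inr c \in rcons L1 (inr h) -> A u' c != 0 -> c = yc.
  by move=> cS uc; apply: (bigE c yc u') => //; apply: big_y.
pose s1 := inl r :: rcons L1 (inr h).
pose q := inr cg :: rcons a2 (inl u').
have eq2 : L2 = a1 ++ q ++ b by rewrite e2 ea /q -catA /= cat_rcons.
have qL2 z : z \in q -> z \in L2 by move=> zq; rewrite eq2 !mem_cat zq orbT.
have iq : induced (entry_weight A) q.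
  by have := i2; rewrite eq2 -cat_cons => /induced_catr /induced_catl.
have uq : uniq q by have := u2; rewrite eq2 cons_uniq !cat_uniq => /and5P[_ _ _ ->].
have qa z : z \in q -> z = inl u' \/ z \in a /\ (z = inr cg \/ z \in a2).
  rewrite inE mem_rcons inE => /or3P[/eqP->|/eqP->|za2]; [right|left|right] => //.
    by split=> //; left.
  by rewrite ea mem_cat inE za2 !orbT; split=> //; right.
have s1row w : inl w \in s1 -> inl w \in inl r :: L1.
  by rewrite /s1 -rcons_cons mem_rcons inE.
have s1col c : inr c \in s1 -> inr c \in rcons L1 (inr h).
  by rewrite /s1 inE.
(* The ear touches the cycle only at its two ends. *)
have E1 v' z : v' \in q -> z \in s1 -> adjA v' z ->
    (v' = inr cg /\ z = inl xv) \/ (v' = inl u' /\ z = inr yc).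
  move=> v'q zs; case/qa: (v'q) => [->|[v'a]].
    case: z zs => // c /s1col cs; rewrite adj_rc => uc; right; split=> //.
    by rewrite (yuniq c).
  case=> [->|v'a2].
    case: z zs => // w /s1row ws; rewrite adj_cr => wc; left; split=> //.
    by rewrite (xuniq w).
  case: v' v'a v'a2 {v'q} => [w|c] wa wa2; case: z zs => // z zs wz.
    case/hasPn/(_ _ wa)/negP: Ba; rewrite /B /=; apply/hasP; exists (inr z) => //.
  case/hasPn/(_ _ wa2)/negP: Ga2; rewrite /G; apply/andP; split=> //.
  by apply/hasP; exists (inl z) => //; apply: s1row.
have disj z : z \in q -> z \notin s1.
  move=> zq; case: z zq => [w|c] zq.
    apply/negP => /s1row; rewrite inE => /orP[/eqP[wr]|wL1].
      by have := row_in_X light2 (qL2 _ zq); rewrite wr (negbTE rX2).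
    exact: X12 (row_in_X light1 wL1) (row_in_X light2 (qL2 _ zq)).
  case/qa: (zq) => // [[ca _]]; apply/negP => /s1col; rewrite mem_rcons inE.
  by have [h1 h2] := Ca c ca; rewrite (negbTE h1) orbF => /eqP[] e; rewrite e eqxx in h2.
(* Adjacent ends would leave only the ear from r to h, and then u and v are not
   adjacent. *)
have nxy : ~~ adjA (inl xv) (inr yc).
  rewrite adj_rc; apply/negP => xy.
  have [/andP[/eqP exr /eqP eyh]|nrh] := boolP ((xv == r) && (yc == h)).
    have a1n : a1 = [::].
      apply: (light_chord light2 (a := [::]) (u := inl r) (v := inr cg) (c := rcons a2 (inl u') ++ b)).
        by rewrite eq2.
      by rewrite adj_rc -exr.
    have bn : b = [::] by apply: (light_end light2 e2); rewrite adj_rc -eyh.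
    have v0q : v \in q by move: v0L; rewrite eq2 a1n bn cats0.
    have us1 : u \in s1 by rewrite inE mem_rcons inE u0L !orbT.
    rewrite adjC in uv0; case: (E1 _ _ v0q us1 uv0) => [[_ e]|[_ e]]; rewrite e in u0L.
      by move: u1; rewrite /= -exr u0L.
    by have := col_neq_h light1 u0L; rewrite eyh eqxx.
  have [exr|xr] := eqVneq xv r.
    rewrite exr eqxx /= in nrh; rewrite exr in xy.
    by have := spoke nrh xy; rewrite (big_y yc).
  have xX : xv \in X1.
    by move: xS; rewrite inE => /orP[/eqP[e]|/(row_in_X light1)//]; rewrite e eqxx in xr.
  have cbig := cross_big cgh xX v2X xg v2c.
  have ecy : cg = yc by apply: (bigE cg yc xv) => //; apply: big_y.
  move: yS; rewrite mem_rcons inE -ecy (negbTE cgL1) orbF => /eqP[] e.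
  by rewrite e eqxx in cgh.
have xs1 : inl xv \in s1 by rewrite /s1 -rcons_cons mem_rcons inE xS orbT.
have ys1 : inr yc \in s1 by rewrite /s1 inE yS orbT.
case/rot_to: xs1 => i s' es'.
have : inr yc \in s' by move: ys1; rewrite -(mem_rot i) es' inE.
move=> /splitPr ys'; case: ys' es' => l1 l2 es'.
have hr : hole (entry_weight A) (inl xv :: l1 ++ inr yc :: l2) by rewrite -es' hole_rot.
have er : cycle_sign (entry_weight A) (inl xv :: l1 ++ inr yc :: l2) = 1.
  by apply: hole_even.
have ur : uniq (inl xv :: l1 ++ inr yc :: l2) by case/and4P: hr.
have mems1 z : z \in s1 = (z \in inl xv :: l1 ++ inr yc :: l2).
  by rewrite -es' mem_rot.
have inl12 z : z \in l1 ++ l2 -> [/\ z \in s1, z != inl xv & z != inr yc].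
  move=> zl; split.
  - by move: zl; rewrite mems1 inE !mem_cat inE => /orP[] ->; rewrite !orbT.
  - apply: contraTneq zl => ->; move: ur; rewrite /= !mem_cat inE.
    by case/andP; rewrite !negb_or => /andP[-> /andP[_ ->]].
  - apply: contraTneq zl => ->; move: ur; rewrite cons_uniq => /andP[_].
    by rewrite uniq_catC /= mem_cat orbC -mem_cat => /andP[].
have : exists2 s, hole (entry_weight A) s & cycle_sign (entry_weight A) s = -1.
  apply: (ear_odd_hole bwk bwu bws hr er (q := q)) => //.
  - rewrite /q /= adj_rc xg rcons_path last_rcons adj_rc uy andbT.
    exact: induced_path iq.
  - have pe : perm_eq (inl xv :: q ++ inr yc :: l1 ++ l2)
                (q ++ inl xv :: l1 ++ inr yc :: l2).
      by apply/permP=> p; rewrite /= !count_cat /= !count_cat /=; clear; lia.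
    rewrite (perm_uniq pe) cat_uniq uq ur andbT andTb; apply/hasPn => z.
    by rewrite -mems1 => zs; apply/negP => /disj; rewrite zs.
  - move=> v' z v'q zl; have [zs zx zy] := inl12 z zl; apply/negP => vz.
    by case: (E1 v' z v'q zs vz) => [[_ e]|[_ e]]; [rewrite e eqxx in zx|rewrite e eqxx in zy].
  - apply: (@uniq_count_le1 _ _ _ (inr cg)) => // z zq; rewrite adjC => xz.
    have xs : inl xv \in s1 by rewrite mems1 mem_head.
    by case: (E1 z _ zq xs xz) => [[]|[_]].
  - apply: (@uniq_count_le1 _ _ _ (inl u')) => // z zq; rewrite adjC => xz.
    by case: (E1 z _ zq ys1 xz) => [[_]|[]].
  - move=> z zq; have xs : inl xv \in s1 by rewrite mems1 mem_head.
    have hx : adjA z (inl xv) -> z = inr cg.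
      by move=> zx; case: (E1 z _ zq xs zx) => [[]|[_]].
    have hy : adjA z (inr yc) -> z = inl u'.
      by move=> zy; case: (E1 z _ zq ys1 zy) => [[_]|[]].
    rewrite -[count _ _]/(adjA z (inl xv) + (adjA z (inr yc) + count (adjA z) q))%N.
    have c2 := induced_count bwk bws iq zq.
    case: (boolP (adjA z (inl xv))) => [/hx ez|_].
      have := induced_count_head iq; rewrite {}ez /q => h1; rewrite -add1n.
      by apply: (@leq_add _ _ 1 1).
    case: (boolP (adjA z (inr yc))) => [/hy ez|_] //.
    have := iq; rewrite /q -rcons_cons => /(induced_count_last bwk).
    have -> : count (adjA z) q = count (adjA z) (inr cg :: a2).
      rewrite ez /q -rcons_cons -cats1 count_cat.
      by rewrite [X in (_ + X)%N](_ : _ = 0%N) ?addn0 //= (adj_irr bws).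
    by rewrite {}ez => h1; rewrite add0n -add1n; apply: (@leq_add _ _ 1 1).
by case=> s hs es; have := no_odd_hole hs; rewrite es eqxx.
Qed.

End Crossing.

(** * The obstruction in the row-column graph *)

(** Such a cycle yields a mixed odd cycle because, on its rows, each of its
    columns has exactly two nonzero entries. *)
Definition odd_hole k (A : 'M[int]_k) s :=
  hole (entry_weight A) s /\ cycle_sign (entry_weight A) s = -1.

(** The hyperarc h and the root r of a tree house with its three paths,
    each given by its nodes after r; its last node is a neighbour of h.  The
    cycles that they close are induced and even, and there are no adjacencies
    between different paths. *)
Definition tree_house_graph k (A : 'M[int]_k) r h (L : 'I_3 -> seq (node k)) :=
  [/\ A r h != 0,
      forall i, hole (entry_weight A) (inl r :: rcons (L i) (inr h)),
      forall i, cycle_sign (entry_weight A) (inl r :: rcons (L i) (inr h)) = 1,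
      forall i j u v, i != j -> u \in L i -> v \in L j -> ~~ adj (entry_weight A) u v
    & forall i j u, i != j -> u \in L i -> u \notin L j].

(** One step along a column which the weighting x, y balances. *)
Lemma pm1_opposite_terms (x y a b : int) : pm1 x -> pm1 y -> pm1 a -> pm1 b ->
  x * a + y * b = 0 -> - a * b = x * y.
Proof.
by case/orP=> /eqP-> /orP[] /eqP-> /orP[] /eqP-> /orP[] /eqP->; clear; lia.
Qed.

Lemma pm1_equal_terms (x y a b s : int) : pm1 x -> pm1 y -> pm1 a -> pm1 b ->
  x * a = s -> y * b = s -> x * y * - b * a = -1.
Proof.
by case/orP=> /eqP-> /orP[] /eqP-> /orP[] /eqP-> /orP[] /eqP->; clear; lia.
Qed.

Section Existence.
Variables (k : nat) (A : 'M[int]_k).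
Hypothesis entries : forall v c, ternary (A v c).
Hypothesis minors : forall k' (f g : 'I_k' -> 'I_k), (k' < k)%N ->
  injective f -> injective g -> ternary (\det (mxsub f g A)).
Hypothesis det_big : ~~ ternary (\det A).
Local Notation sz c := #|colsupp A c|.
Hypothesis big_disjoint : forall c c' v, c != c' -> (4 <= sz c)%N ->
  (4 <= sz c')%N -> A v c != 0 -> A v c' = 0.
Local Notation S := (\adj A).
Local Notation adjA := (adj (entry_weight A)).

Let S_pm1 c v : pm1 (S c v) := adj_pm1 minors det_big c v.

Section Reach.
Variables (X : {set 'I_k}) (h : 'I_k) (a : node k).

Definition step : rel (node k) :=
  fun x y => adjA x y && (allowed X h x && allowed X h y).

Definition reached v := (v \in X) && connect step a (inl v).

(** The rows of X in a column other than h are reached all together or not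
    at all. *)
Lemma reached_sum (z : 'I_k -> int) c : c != h ->
  \sum_v (if reached v then z v else 0) * A v c =
  if connect step a (inr c) then \sum_(v in X) z v * A v c else 0.
Proof.
move=> ch.
have cv v : v \in X -> A v c != 0 -> connect step a (inl v) = connect step a (inr c).
  move=> vX vc; apply/idP/idP => h1; apply: (connect_trans h1); apply: connect1.
    by rewrite /step adj_rc vc /= vX ch.
  by rewrite /step adj_cr vc /= vX ch.
case: ifP => ac.
  rewrite [RHS]big_mkcond; apply: eq_bigr => v _; rewrite /reached.
  have [vX|_] := boolP (v \in X); last by rewrite mul0r.
  have [->|vc] := eqVneq (A v c) 0; first by rewrite !mulr0.
  by rewrite /= cv // ac.
apply: big1 => v _; rewrite /reached.
have [vX|_] := boolP (v \in X); last by rewrite mul0r.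
have [->|vc] := eqVneq (A v c) 0; first by rewrite !mulr0.
by rewrite /= cv // ac mul0r.
Qed.

Lemma reached_path b : connect step a b ->
  exists2 p, path adjA a p && all (allowed X h) p & last a p = b.
Proof.
case/connectP=> p pp ->; exists p => //; elim: p (a) pp => //= y p IH x.
by case/andP=> /andP[-> /andP[_ ->]] /IH.
Qed.

End Reach.

(** If no row of h were reached from f inside the branch, then row h of the
    adjugate, truncated to the rows that are reached, would combine the rows of
    A to the unit vector of f up to sign. *)
Lemma branch_route s h r f : \det A = 2 * s -> pm1 s -> (4 <= sz h)%N ->
  A r h != 0 -> S h r * A r h = - s -> f \in spokes A h r ->
  exists L, route A (branch A h r f) h r L.
Proof.
move=> ds ps hb rh rhs fs; set X := branch A h r f.
have [fh rf] : f != h /\ A r f != 0 by apply/andP; move: fs; rewrite inE.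
have [/existsP[v /andP[/andP[vX /reached_path[p /andP[pp ap] lp]] vh]]|no] :=
    boolP [exists v, reached X h (inr f) v && (A v h != 0)].
  exists (inr f :: p); apply/and4P; split=> //=.
  - by rewrite adj_rc rf.
  - by rewrite fh.
  - by rewrite lp adj_rc.
exfalso.
apply: (no_integral_inverse_row minors det_big
  (z := fun v => if reached X h (inr f) v then S h v else 0) (c0 := f)).
  rewrite reached_sum // connect0.
  exact: (branch_balance1 entries minors det_big big_disjoint ds ps hb rh rhs).
move=> c cf; have [->|ch] := eqVneq c h.
  apply: big1 => v _; case: ifP => hv; last by rewrite mul0r.
  move: no; rewrite negb_exists => /forallP/(_ v); rewrite hv negbK => /eqP->.
  by rewrite mulr0.
rewrite reached_sum //; case: ifP => // _.
exact: (branch_balance0 entries minors det_big big_disjoint ds ps hb rh rhs).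
Qed.

(** A column of size 2 meeting both branches has a single row in the first
    one, where it would have to be balanced; column f itself has only one row
    besides r. *)
Lemma branch_cross_big s h r f f' c v v' : \det A = 2 * s -> pm1 s ->
  (4 <= sz h)%N -> A r h != 0 -> S h r * A r h = - s ->
  f \in spokes A h r -> f' \in spokes A h r -> f != f' -> c != h ->
  v \in branch A h r f -> v' \in branch A h r f' ->
  A v c != 0 -> A v' c != 0 -> (4 <= sz c)%N.
Proof.
move=> ds ps hb rh rhs fs fs' ff' ch vX vX' vc vc'; apply: contraT => csmall.
have c2 := col_small entries minors det_big csmall.
have three x y z : A x c != 0 -> A y c != 0 -> A z c != 0 ->
    x != y -> y != z -> z != x -> False.
  move=> xc yc zc xy yz zx; have : (2 < sz c)%N.
    by apply/card_gt2P; exists x, y, z; rewrite !inE.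
  by rewrite c2.
have disj := branch_disjoint entries minors det_big big_disjoint ds ps hb rh rhs fs fs' ff'.
have vv' : v != v' by apply: contraTneq vX' => <-; apply/negP=> /(disj v vX).
have notr w g : w \in branch A h r g -> w != r by rewrite inE => /andP[].
have [cf|cf] := eqVneq c f.
  exfalso; apply: (three r v v') => //.
  - by move: fs; rewrite inE cf => /andP[].
  - by rewrite eq_sym (notr _ f).
  - by rewrite (notr _ f').
have := branch_balance0 entries minors det_big big_disjoint ds ps hb rh rhs fs ch cf.
rewrite (bigD1 v) //= big1 ?addr0 => [/eqP|w /andP[wX wv]].
  by rewrite mulf_eq0 (negbTE vc) orbF; case/orP: (S_pm1 h v) => /eqP->.
have [->|wc] := eqVneq (A w c) 0; first by rewrite mulr0.
exfalso; apply: (three v v' w) => //.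
by apply: contraTneq vX' => ->; apply/negP=> /(disj w wX).
Qed.

Lemma big_obstruction h : (4 <= sz h)%N ->
  (forall s, hole (entry_weight A) s -> cycle_sign (entry_weight A) s != -1) ->
  exists r L, tree_house_graph A r h L.
Proof.
move=> hb nh.
have [s ps ds] := det_pm2 entries minors det_big big_disjoint.
have [r rh rhs] := big_col_center entries minors det_big ds ps hb.
have c3 := card_spokes entries minors det_big big_disjoint ds ps hb rh rhs.
pose f (i : 'I_3) := enum_val (cast_ord (esym c3) i).
have fs i : f i \in spokes A h r by apply: enum_valP.
have fi i j : i != j -> f i != f j.
  by apply: contraNneq => /enum_val_inj/cast_ord_inj->.
have : forall i, exists L, light_route A (branch A h r (f i)) h r L.
  move=> i; have [L /light_route_exists] := branch_route ds ps hb rh rhs (fs i).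
  by [].
case/fin_all_exists=> L light.
have rX i : r \notin branch A h r (f i) by rewrite inE eqxx.
have clean i j u v : i != j -> u \in L i -> v \in L j -> ~~ adjA u v.
  move=> ij; apply: (light_routes_clean entries big_disjoint nh rh hb (rX i) (rX j) _ (light i) (light j)).
  - move=> w; exact: (branch_disjoint entries minors det_big big_disjoint ds ps hb rh rhs (fs i) (fs j) (fi _ _ ij)).
  - move=> c ch rc; rewrite (spoke_small entries minors det_big big_disjoint hb rh) //.
    by rewrite inE ch rc.
  - move=> c w w' ch; exact: (branch_cross_big ds ps hb rh rhs (fs i) (fs j) (fi _ _ ij)).
have holes i := sector_hole (rX i) rh (light i).
exists r, L; split=> // [i|i j u ij ui]; first exact: (hole_even entries nh).
apply/negP=> uj; case: u ui uj => [w|c] ui uj.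
  exact: (branch_disjoint entries minors det_big big_disjoint ds ps hb rh rhs (fs i) (fs j) (fi _ _ ij)
    (row_in_X (light i) ui) (row_in_X (light j) uj)).
have [w wj wc] := col_next (light j) uj.
by have := clean i j _ _ ij ui wj; rewrite adj_cr wc.
Qed.

(** Row h of the adjugate is balanced on each column of size 2 along the
    walk, so it acts as a potential and the product telescopes. *)
Lemma small_walk_sign h r z L : (forall c, sz c = 2%N) ->
  path adjA (inl r) L -> uniq (inl r :: L) ->
  {in L, forall x, x != inr h} -> last (inl r) L = inl z ->
  walk_sign (entry_weight A) (inl r) L = S h r * S h z.
Proof.
move=> small.
have [n sn] := ubnP (size L); elim: n L r sn => // n IH [|x [|y L]] r sn.
- by move=> _ _ _ [->]; rewrite pm1_sqr.
- by case: x {sn} => [v|c] //= /andP[].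
have {}sn : (size L < n)%N by move: sn; rewrite /= !ltnS => /ltnW.
case: x y => [w|c] [v|c'] //=; rewrite ?andbF // => /and3P[rc cv pL].
rewrite !inE !negb_or => /and4P[/andP[_ /andP[rv _]] _ vL uL] hL lL.
rewrite IH //=; last 2 first.
- by rewrite vL.
- by move=> x xL; apply: hL; rewrite !inE xL !orbT.
have ch : c != h by have := hL (inr c); rewrite mem_head => /(_ isT).
rewrite mulrA; rewrite adj_rc in rc; rewrite adj_cr in cv.
have rv' : r != v by apply: contraNneq rv => ->.
have ec : colsupp A c = [set r; v].
  apply/esym/eqP; rewrite eqEcard small cards2 rv' andbT.
  by apply/subsetP=> w; rewrite !inE => /orP[] /eqP->.
have := mul_adj_col A h c; rewrite eq_sym (negbTE ch) mulr0 supp_sum ec.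
rewrite big_setU1 ?inE //= big_set1.
move/pm1_opposite_terms => -> //; try exact: (entry_pm1 entries).
by rewrite -mulrA (mulrA (S h v)) pm1_sqr // mul1r.
Qed.

(** Avoiding h, an induced path joins its two rows u and w, by truncation of
    the weighting as in [branch_route].  The terms of u and w in column h are
    equal, so the closing steps through h contribute the sign opposite to that
    of the path. *)
Lemma small_obstruction : (forall c, sz c = 2%N) -> exists s, odd_hole A s.
Proof.
move=> small; have k1 := order_gt1 entries det_big.
pose h := Ordinal (ltnW k1).
have /eqP/cards2P[u [w [uw eh]]] := small h.
have uh : A u h != 0 by have : u \in colsupp A h by [rewrite eh !inE eqxx]; rewrite inE.
have wh : A w h != 0 by have : w \in colsupp A h by [rewrite eh !inE eqxx orbT]; rewrite inE.
have [s ps ds] := det_pm2 entries minors det_big big_disjoint.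
have [ruw|nruw] := boolP (reached setT h (inl u) w); last first.
  exfalso; apply: (no_integral_inverse_row minors det_big
    (z := fun v => if reached setT h (inl u) v then S h v else 0) (c0 := h)).
    rewrite supp_sum eh big_setU1 ?inE //= big_set1 (negbTE nruw) mul0r addr0.
    by rewrite /reached inE connect0; apply: pm1_mul => //; apply: entry_pm1.
  move=> c ch; rewrite reached_sum //; case: ifP => // _.
  by under eq_bigl do rewrite inE; rewrite mul_adj_col eq_sym (negbTE ch) mulr0.
have /andP[_ /reached_path[p0 /andP[pp0 ap0] lp0]] := ruw.
case: (shortenP pp0) lp0 => p pp up sub lp.
have ap : all (allowed [set~ u] h) p.
  apply/allP => x xp; have := allP ap0 x (sub x xp).
  case: x xp => //= v vp _; rewrite !inE; apply: contraTneq vp => ->.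
  by case/andP: up.
have rp : route A [set~ u] h u p.
  apply/and4P; split=> //; last by rewrite lp adj_rc.
  by apply: contraNneq uw => p0'; move: lp; rewrite p0' => -[->].
have [L lr] := light_route_exists rp.
have uX : u \notin [set~ u] by rewrite !inE eqxx.
have hL := sector_hole uX uh lr.
have uL := light_uniq uX lr.
exists (inl u :: rcons L (inr h)); split=> //=.
have [L0 [z [eL zh _]]] := light_last lr.
have /and4P[_ pL aL _] := route_L lr.
have ez : z = w.
  have : z \in colsupp A h by rewrite inE.
  rewrite eh !inE => /orP[/eqP zu|/eqP//].
  by move: uL; rewrite eL /= mem_rcons inE zu eqxx.
rewrite !walk_sign_rcons last_rcons (small_walk_sign (h := h) (z := z)) //; first last.
- by rewrite eL last_rcons.
- by move=> x xL; apply/eqP => ex; have := allP aL x xL; rewrite ex /= ?eqxx.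
rewrite eL last_rcons /= ez.
apply: (pm1_equal_terms (s := s)); rewrite ?S_pm1 ?(entry_pm1 entries) //.
  exact: (small_entry entries minors det_big ds ps (small h) uh).
exact: (small_entry entries minors det_big ds ps (small h) wh).
Qed.

Theorem minimal_matrix_obstruction :
  (exists s, odd_hole A s) \/ exists r h L, tree_house_graph A r h L.
Proof.
have [/existsP[h hb]|no] := boolP [exists h, (4 <= sz h)%N].
  case: (classic (exists s, odd_hole A s)) => [|nh]; [by left|right].
  have [] := big_obstruction hb; last by move=> r [L hL]; exists r, h, L.
  by move=> s hs; apply/negP => /eqP es; apply: nh; exists s.
left; apply: small_obstruction => c; apply: (col_small entries minors det_big).
by move: no; rewrite negb_exists => /forallP/(_ c).
Qed.

End Existence.

(** * Partial subhypergraphs given by a cycle or a path *)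

Lemma cardsI2 (T : finType) (S : {set T}) x y : x != y ->
  #|S :&: [set x; y]| = ((x \in S) + (y \in S))%N.
Proof.
move=> xy; have -> : S :&: [set x; y] = (S :&: [set x]) :|: (S :&: [set y]).
  by rewrite setIUr.
have c z : #|S :&: [set z]| = (z \in S).
  have [zS|zS] := boolP (z \in S).
    by rewrite (setIidPr _) ?cards1 // sub1set.
  by apply/eqP; rewrite cards_eq0 setI_eq0 disjoint_sym disjoints1.
rewrite cardsU !c (_ : _ :&: _ = set0) ?cards0 ?subn0 //.
by apply/setP=> z; rewrite !inE; have [->|_] := eqVneq z x; rewrite ?(negbTE xy) !andbF.
Qed.

Lemma ordS_neq m (i : 'I_m) : (1 < m)%N -> i != ordS i.
Proof.
case: m i => // m i m1; apply/eqP => /(congr1 val) /=; have := ltn_ord i.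
have [im|mi] := ltnP i.+1 m.+1; first by rewrite modn_small //; clear; lia.
have -> : i.+1 = m.+1 by have := ltn_ord i; move: mi; clear; lia.
by rewrite modnn; move: mi m1; clear; lia.
Qed.

Section Hyper.
Variables (V : finType) (H : mixed_hypergraph V).

Lemma incidence_neq0 v (a : arc H) : (incidence v a != 0) = (v \in supp a).
Proof. by rewrite /incidence /supp inE; case: ifP => //; case: ifP. Qed.

Lemma incidence_ternary v (a : arc H) : ternary (incidence v a).
Proof. by rewrite /incidence; case: ifP => //; case: ifP. Qed.

(** The value of [par] on the restriction of a hyperarc to U, computed in H so
    that nested restrictions need not be unfolded. *)
Definition par_in (U : {set V}) (a : arc H) : nat :=
  ((#|src a :&: U| == 2) || (#|tgt a :&: U| == 2))%N.

(** Equal incidences have product 1 and opposite ones -1. *)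
Lemma par_in_sign U (a : arc H) x y : x != y -> supp a :&: U = [set x; y] ->
  (-1) ^+ par_in U a = - incidence x a * incidence y a.
Proof.
move=> xy e.
have eS (S : {set V}) : S \subset supp a -> S :&: U = S :&: [set x; y].
  by move=> sS; rewrite -e setIA (setIidPl sS).
have e1 : src a :&: U = src a :&: [set x; y] by apply: eS; rewrite subsetUl.
have e2 : tgt a :&: U = tgt a :&: [set x; y] by apply: eS; rewrite subsetUr.
have xs : x \in supp a by have : x \in supp a :&: U; [rewrite e !inE eqxx | case/setIP].
have ys : y \in supp a by have : y \in supp a :&: U; [rewrite e !inE eqxx orbT | case/setIP].
have dis z : z \in src a -> (z \in tgt a) = false.
  by move=> zs; apply: (disjointFr (src_tgt_disjoint a)).
rewrite /par_in e1 e2 !cardsI2 // /incidence.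
move: xs ys; rewrite /supp !inE.
have [xs _|xs /= ->] := boolP (x \in src a); have [ys _|ys /= ->] := boolP (y \in src a);
by rewrite ?(dis x xs) ?(dis y ys).
Qed.

Lemma supp_restr U (F : {set arc H}) (a : arc (restr U F)) :
  supp a = supp (val a) :&: U.
Proof. by rewrite /supp setIUl. Qed.

Lemma restr_arcP U (F : {set arc H}) a : a \in F -> supp a :&: U != set0 ->
  (a \in F) && ((src a :&: U) :|: (tgt a :&: U) != set0).
Proof. by move=> -> ; rewrite -setIUl. Qed.

Lemma restr_family_bij m U (a : 'I_m -> arc H) :
  injective a -> (forall i, supp (a i) :&: U != set0) ->
  exists2 e : 'I_m -> arc (restr U [set a i | i : 'I_m]),
    bijective e & forall i, val (e i) = a i.
Proof.
move=> ia ne; set F := [set a i | i : 'I_m].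
have aF i : a i \in F by apply: imset_f.
pose e i : arc (restr U F) := exist _ (a i) (restr_arcP (aF i) (ne i)).
exists e => //; apply: inj_card_bij => [i j /(congr1 val)/ia //|].
rewrite card_ord; apply: (@leq_trans #|F|).
  rewrite card_sig; apply: subset_leq_card.
  by apply/subsetP=> x; rewrite !inE => /andP[].
by rewrite (leq_trans (leq_imset_card _ _)) // card_ord.
Qed.

Lemma restr_mixed_path m (v : 'I_m.+1 -> V) (a : 'I_m -> arc H) :
  injective v -> injective a ->
  (forall i, supp (a i) :&: [set v j | j : 'I_m.+1]
     = [set v (widen_ord (leqnSn m) i); v (lift ord0 i)]) ->
  mixed_path (restr [set v j | j : 'I_m.+1] [set a i | i : 'I_m])
    (v ord0) (v ord_max).
Proof.
move=> iv ia hs; set U := [set v j | j : _].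
have ne i : supp (a i) :&: U != set0.
  by rewrite hs; apply/set0Pn; exists (v (lift ord0 i)); rewrite !inE eqxx orbT.
have [e be ve] := restr_family_bij ia ne.
exists m, v, e; split=> // i.
by rewrite /= supp_restr ve hs.
Qed.

(** The parity is given as a product of signs for comparison with
    [cycle_sign]. *)
Lemma restr_mixed_cycle m (v : 'I_m -> V) (a : 'I_m -> arc H) : (2 <= m)%N ->
  injective v -> injective a ->
  (forall i, supp (a i) :&: [set v j | j : 'I_m] = [set v i; v (ordS i)]) ->
  mixed_cycle (restr [set v j | j : 'I_m] [set a i | i : 'I_m]) /\
  (-1) ^+ (odd_parity (restr [set v j | j : 'I_m] [set a i | i : 'I_m])) =
  \prod_(i < m) (- incidence (v i) (a i) * incidence (v (ordS i)) (a i)).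
Proof.
move=> m2 iv ia hs; set U := [set v j | j : _].
have ne i : supp (a i) :&: U != set0.
  by rewrite hs; apply/set0Pn; exists (v i); rewrite !inE eqxx.
have [e be ve] := restr_family_bij ia ne; split.
  exists m, v, e; split=> // i.
  by rewrite /= supp_restr ve hs.
have vS i : v i != v (ordS i) by rewrite (inj_eq iv) ordS_neq.
rewrite signr_odd (reindex e) /=; last by case: be => f ef fe; exists f => ? _.
rewrite -prodrXr; apply: eq_bigr => i _.
rewrite -(par_in_sign (vS i) (hs i)).
by rewrite /par_in -ve.
Qed.

Lemma restr_contained (U : {set V}) (F : {set arc H}) : U \subset vert H ->
  contains H (restr U F).
Proof.
move=> UH; exists (restr U F); split.
  by split=> //; exists val; split=> //; apply: val_inj.
exists id, id; split=> //; exact: (Bijective (fun=> erefl) (fun=> erefl)).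
Qed.

End Hyper.

(** * Induced cycles as indexed families *)

Lemma walk_sign_prod (N : finType) (w : N -> N -> int) x p :
  walk_sign w x p = \prod_(i < size p) w (nth x (x :: p) i) (nth x (x :: p) i.+1).
Proof.
elim: p x => [|y p IH] x /=; first by rewrite big_ord0.
rewrite big_ord_recl /= IH; congr (_ * _); apply: eq_bigr => i _ /=.
rewrite add0n; have ip := ltn_ord i; congr (w _ _); apply: set_nth_default => //.
by rewrite ltnS ltnW.
Qed.

Lemma prod_pairs (F : nat -> int) n :
  \prod_(i < n.*2) F i = \prod_(i < n) (F i.*2 * F i.*2.+1).
Proof.
elim: n => [|n IH]; first by rewrite !big_ord0.
by rewrite doubleS !big_ord_recr /= IH mulrA.
Qed.

(** Form of an induced cycle of the row-column graph in which the hypergraph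
    notions are stated: rows v 0, v 1, ... and columns a 0, a 1, ... such that
    column a i contains, among these rows, precisely v i and its cyclic
    successor. *)
Definition unrolled k (A : 'M[int]_k) S m (v a : 'I_m.+1 -> 'I_k) :=
  [/\ injective v, injective a,
      forall i j, (A (v j) (a i) != 0) = (j == i) || (j == ordS i),
      (forall w, inl w \in S <-> exists j, w = v j) /\
      (forall c, inr c \in S <-> exists j, c = a j)
    & cycle_sign (entry_weight A) S
      = \prod_i (- A (v i) (a i) * A (v (ordS i)) (a i))].

Section Unroll.
Variables (k : nat) (A : 'M[int]_k).

(** Rows and columns alternate, so rows are at the even positions of the list
    and columns at the odd ones; a third row of the cycle in a column would be a
    third neighbour. *)
Lemma hole_unroll r h L : hole (entry_weight A) (inl r :: rcons L (inr h)) ->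
  exists m (v a : 'I_m.+1 -> 'I_k),
  [/\ (0 < m)%N, unrolled A (inl r :: rcons L (inr h)) v a, v ord0 = r
    & a ord_max = h].
Proof.
set S := _ :: _ => hS; have /and4P[uS sS cS /allP chS] := hS.
pose x0 : node k := inl r; pose T := nth x0 (rcons S x0).
have adjT i : (i < size S)%N -> adj (entry_weight A) (T i) (T i.+1).
  by move=> iS; move: cS => /(pathP x0)/(_ i); rewrite size_rcons; apply.
have rowT i : (i <= size S)%N -> is_row (T i) = ~~ odd i.
  elim: i => //= i IH iS; have /entry_weight_side -> := adjT i iS.
  by rewrite IH ?negbK // ltnW.
have TS i : (i < size S)%N -> T i = nth x0 S i by move=> iS; rewrite /T nth_rcons iS.
have Tlast : T (size S).-1 = inr h.
  by rewrite TS // -[(size S).-1]/(size (rcons L (inr h))) size_rcons /S /= nth_rcons ltnn eqxx.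
have T0 : T 0%N = inl r by [].
have TN : T (size S) = inl r by rewrite /T nth_rcons ltnn eqxx.
have oddN : ~~ odd (size S) by rewrite -rowT ?TN.
pose n := (size S)./2.
have eN : size S = n.*2 by rewrite /n -[LHS]odd_double_half (negbTE oddN).
have n2 : (1 < n)%N by move: sS; rewrite eN; clear; lia.
pose m := n.-1; have en : n = m.+1 by rewrite /m prednK // ltnW.
pose v (i : nat) := if T i.*2 is inl w then w else r.
pose a (i : nat) := if T i.*2.+1 is inr c then c else h.
have Tv i : (i <= n)%N -> T i.*2 = inl (v i).
  move=> ni; have := rowT i.*2; rewrite eN leq_double ni odd_double => /(_ isT).
  by rewrite /v; case: (T _).
have Ta i : (i < n)%N -> T i.*2.+1 = inr (a i).
  move=> ni; have := rowT i.*2.+1; rewrite eN ltn_double ni /= odd_double => /(_ isT).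
  by rewrite /a; case: (T _).
have inS i : (i < size S)%N -> T i \in S by move=> iS; rewrite TS // mem_nth.
have injT i j : (i < size S)%N -> (j < size S)%N -> T i = T j -> i = j.
  by move=> iS jS; rewrite !TS // => /eqP; rewrite nth_uniq // => /eqP.
have lt2 (i : nat) : (i < m.+1)%N -> ((i.*2 < size S)%N * (i.*2.+1 < size S)%N)%type.
  by rewrite -en eN => ni; split; move: ni; clear; lia.
have vS (i : 'I_m.+1) : v (ordS i) = v i.+1.
  rewrite /=; have [im|mi] := ltnP i.+1 m.+1; first by rewrite modn_small.
  have -> : i.+1 = n by have := ltn_ord i; rewrite en; move: mi; clear; lia.
  rewrite en modnn; have := Tv n (leqnn n); rewrite -eN TN => -[].
  by rewrite -en => <-; rewrite /v T0.
have nI (i : 'I_m.+1) : (i < n)%N by rewrite en.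
pose v' (i : 'I_m.+1) := v i; pose a' (i : 'I_m.+1) := a i.
have iv : injective v'.
  move=> i j e; have [li _] := lt2 i (ltn_ord i); have [lj _] := lt2 j (ltn_ord j).
  apply/val_inj/double_inj/injT => //.
  have ni := nI i; have nj := nI j.
  by rewrite (Tv _ (ltnW ni)) (Tv _ (ltnW nj)); exact: (congr1 inl e).
have ia : injective a'.
  move=> i j e; have [_ li] := lt2 i (ltn_ord i); have [_ lj] := lt2 j (ltn_ord j).
  apply/val_inj/double_inj/succn_inj/injT => //.
  have ni := nI i; have nj := nI j.
  by rewrite (Ta _ ni) (Ta _ nj); exact: (congr1 inr e).
have adj1 i : (i < n)%N -> A (v i) (a i) != 0.
  move=> ni; have := adjT i.*2; rewrite eN ltn_double ni Tv ?Ta ?(ltnW ni) //.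
  by move=> /(_ isT); rewrite adj_rc.
have adj2 i : (i < n)%N -> A (v i.+1) (a i) != 0.
  move=> ni; have := adjT i.*2.+1; rewrite eN ltn_Sdouble ni Ta // -doubleS Tv //.
  by move=> /(_ isT).
have vinS (i : 'I_m.+1) : inl (v' i) \in S.
  have [l2 _] := lt2 i (ltn_ord i).
  by rewrite /v' -Tv ?en 1?ltnW // inS.
have ainS (i : 'I_m.+1) : inr (a' i) \in S.
  have [_ l2] := lt2 i (ltn_ord i).
  by rewrite /a' -Ta ?en // inS.
exists m, v', a'; split.
- by rewrite -ltnS -en.
- split=> //.
  + move=> i j; apply/idP/orP; last first.
      case=> /eqP->; first by apply: adj1; rewrite en.
      by rewrite /v' vS; apply: adj2; rewrite en.
    move=> ji; apply/orP; apply: contraT; rewrite negb_or => /andP[nji njS].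
    have := chS (inr (a' i)) (ainS i).
    have iiS : i != ordS i by rewrite ordS_neq // -en.
    suff : (3 <= count (adj (entry_weight A) (inr (a' i))) S)%N by case: count => [|[|[]]].
    rewrite -size_filter.
    apply: (@uniq_leq_size _ [:: inl (v' j); inl (v' i); inl (v' (ordS i))]).
      rewrite /= !inE !negb_or !andbT.
      have il (x y : 'I_m.+1) : ((inl (v' x) : node k) == inl (v' y)) = (x == y).
        by rewrite -(inj_eq iv).
      by rewrite !il nji njS iiS.
    move=> x; rewrite !inE mem_filter => /or3P[] /eqP->; rewrite vinS andbT //.
      by apply: adj1; rewrite en.
    by rewrite adj_cr /v' vS; apply: adj2; rewrite en.
  + split=> x; split=> [xS|[j ->] //].
      move: xS => /(nthP x0)[i iS]; rewrite -TS // => ex.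
      have io : ~~ odd i by rewrite -rowT ?ex // ltnW.
      have ei : i = (i./2).*2 by rewrite -[LHS]odd_double_half (negbTE io).
      have i2 : (i./2 < m.+1)%N by rewrite -en -ltn_double -ei -eN.
      exists (Ordinal i2); rewrite /v' /=; have := Tv i./2; rewrite -ei ex en => /(_ (ltnW i2)).
      by case.
    move: xS => /(nthP x0)[i iS]; rewrite -TS // => ex.
    have io : odd i by rewrite -[odd i]negbK -rowT ?ex // ltnW.
    have ei : i = (i./2).*2.+1 by rewrite -[LHS]odd_double_half io.
    have i2 : (i./2 < m.+1)%N by rewrite -en -ltn_Sdouble -ei -eN.
    exists (Ordinal i2); rewrite /a' /=; have := Ta i./2; rewrite -ei ex en => /(_ i2).
    by case.
  + rewrite -[LHS]/(walk_sign (entry_weight A) x0 (rcons (rcons L (inr h)) x0)) walk_sign_prod.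
    have -> : size (rcons (rcons L (inr h)) x0) = n.*2.
      by rewrite size_rcons -eN.
    rewrite (prod_pairs (fun i => entry_weight A (T i) (T i.+1))) en; apply: eq_bigr => i _.
    have ni : (i < n)%N by rewrite en.
    by rewrite -doubleS !Tv ?(ltnW ni) // Ta // /v' vS.
- by rewrite /v' /v T0.
- rewrite /a' /a (_ : _.*2.+1 = (size S).-1) ?Tlast //.
  by rewrite eN en.
Qed.

End Unroll.

(** * From the row-column graph to mixed hypergraphs *)

Lemma hole_row_first k (A : 'M[int]_k) s : hole (entry_weight A) s ->
  exists n r h L, rot n s = inl r :: rcons L (inr h).
Proof.
case/and4P=> _; case: s => [|[r|c] [|y t]] // _ cs _.
  exists 0%N, r; rewrite rot0; move: cs; case/lastP: t y => [|t [z|h]] y.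
  - by case: y => [z|h] /=; rewrite ?andbF // => _; exists h, [::].
  - by rewrite /= rcons_path last_rcons /= andbF andbF.
  - by exists h, (y :: t).
exists 1%N; rewrite rot1_cons; case: y cs => [r _|c'].
  by exists r, c, t.
by case/andP.
Qed.

Lemma incidence_restr (V : finType) (H : mixed_hypergraph V) (U : {set V})
    (F : {set arc H}) x (a : arc (restr U F)) :
  x \in U -> incidence x a = incidence x (val a).
Proof. by move=> xU; rewrite /incidence /= /restr_src /restr_tgt !inE xU !andbT. Qed.

Section Realize.
Variables (V : finType) (D : mixed_hypergraph V) (k : nat) (A : 'M[int]_k).
Variables (phi : 'I_k -> V) (psi : 'I_k -> arc D).
Hypotheses (phi_inj : injective phi) (psi_inj : injective psi).
Hypothesis phi_vert : forall v, phi v \in vert D.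
Hypothesis entryE : forall v c, A v c = incidence (phi v) (psi c).

Lemma mem_supp v c : (phi v \in supp (psi c)) = (A v c != 0).
Proof. by rewrite entryE incidence_neq0. Qed.

Lemma unrolled_supp S m (v a : 'I_m.+1 -> 'I_k) i : unrolled A S v a ->
  supp (psi (a i)) :&: [set phi (v j) | j : 'I_m.+1]
  = [set phi (v i); phi (v (ordS i))].
Proof.
case=> iv ia adjE _ _; apply/setP=> x; rewrite in_setI in_set2.
apply/andP/orP => [[xs /imsetP[j _ ex]]|].
  by move: xs; rewrite ex mem_supp adjE => /orP[] /eqP->; rewrite eqxx; [left|right].
by case=> /eqP->; rewrite mem_supp adjE eqxx ?orbT imset_f.
Qed.

Lemma odd_hole_contained s : odd_hole A s ->
  exists (W : finType) (C : mixed_hypergraph W), mixed_odd_cycle C /\ contains D C.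
Proof.
case=> hs sg; have [n [r [h [L e]]]] := hole_row_first hs.
move: hs sg; rewrite -(hole_rot _ n) -(cycle_sign_rot _ n) e.
move=> /hole_unroll[m [v [a [m0 un _ _]]]] sg.
have [iv ia _ _ sE] := un.
pose vv j := phi (v j); pose aa j := psi (a j).
have ivv : injective vv by move=> x y /phi_inj/iv.
have iaa : injective aa by move=> x y /psi_inj/ia.
have [cyc par] := restr_mixed_cycle (v := vv) (a := aa) m0 ivv iaa
  (fun i => unrolled_supp i un).
exists V; eexists; split; last first.
  apply: (restr_contained (U := [set vv j | j : 'I_m.+1]) [set aa j | j : 'I_m.+1]).
  by apply/subsetP=> x /imsetP[j _ ->]; apply: phi_vert.
split=> //; move: par; under eq_bigr do rewrite -!entryE.
by rewrite -sE sg; case: odd_parity.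
Qed.

(** The tree house is the restriction of D to the rows and columns of the
    three cycles.  Cycles share only r and h, and a column other than h has no
    row on another cycle except possibly r; so its ends in the restriction are
    its two neighbours on its own cycle. *)
Lemma tree_house_graph_contained r h L : tree_house_graph A r h L ->
  exists (W : finType) (H : mixed_hypergraph W), mixed_tree_house H /\ contains D H.
Proof.
case=> rh holes even clean disj.
have /fin_all_exists[m] : forall i, exists m, exists v a : 'I_m.+1 -> 'I_k,
    [/\ (0 < m)%N, unrolled A (inl r :: rcons (L i) (inr h)) v a, v ord0 = r
      & a ord_max = h].
  by move=> i; apply: hole_unroll.
move/fin_all_exists=> [v /fin_all_exists[a un]].
have m0 i : (0 < m i)%N by case: (un i).
have v0 i : v i ord0 = r by case: (un i).
have amax i : a i ord_max = h by case: (un i).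
have {}un i : unrolled A (inl r :: rcons (L i) (inr h)) (v i) (a i) by case: (un i).
have iv i : injective (v i) by case: (un i).
have ia i : injective (a i) by case: (un i).
have adjE i j j' : (A (v i j') (a i j) != 0) = (j' == j) || (j' == ordS j) by case: (un i).
have vL i j : v i j != r -> inl (v i j) \in L i.
  move=> jr; have [_ _ _ [h1 _] _] := un i.
  have : inl (v i j) \in inl r :: rcons (L i) (inr h) by apply/h1; exists j.
  rewrite inE mem_rcons inE => /or3P[/eqP[e]|//|//]; by rewrite e eqxx in jr.
have aL i j : j != ord_max -> inr (a i j) \in L i.
  move=> jr; have [_ _ _ [_ h1] _] := un i.
  have : inr (a i j) \in inl r :: rcons (L i) (inr h) by apply/h1; exists j.
  rewrite inE mem_rcons inE => /or3P[//|/eqP[e]|//].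
  by move: e jr; rewrite -(amax i) => /ia->; rewrite eqxx.
(* The last column of every cycle is h, so the columns of the path come before. *)
have K0 i j i' j' : j != ord_max -> A (v i' j') (a i j) != 0 ->
    v i' j' = v i j \/ v i' j' = v i (ordS j).
  move=> jm; have [ii'|ii'] := eqVneq i i'.
    by subst i'; rewrite adjE => /orP[] /eqP->; [left|right].
  have [->|nr] := eqVneq (v i' j') r.
    by rewrite -(v0 i) adjE => /orP[] /eqP->; [left|right].
  have := clean i i' _ _ ii' (aL i j jm) (vL i' j' nr).
  by rewrite adj_cr => /negbTE->.
pose U i := [set phi (v i j) | j : 'I_(m i).+1].
pose Ut := \bigcup_i U i.
pose F := \bigcup_i [set psi (a i j) | j : 'I_(m i).+1].
have vU i j : phi (v i j) \in U i by apply: imset_f.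
have vUt i j : phi (v i j) \in Ut by apply/bigcupP; exists i.
have aP i j : (psi (a i j) \in F) &&
    ((src (psi (a i j)) :&: Ut) :|: (tgt (psi (a i j)) :&: Ut) != set0).
  apply: restr_arcP; first by apply/bigcupP; exists i => //; apply: imset_f.
  by apply/set0Pn; exists (phi (v i j)); rewrite inE vUt mem_supp adjE eqxx.
pose H := restr Ut F.
pose b i j : arc H := exist _ (psi (a i j)) (aP i j).
have suppb i j : supp (b i j) = supp (psi (a i j)) :&: Ut by rewrite supp_restr.
have ib i : injective (b i) by move=> j j' /(congr1 val)/psi_inj/ia.
have K1 i j : j != ord_max -> supp (b i j) = [set phi (v i j); phi (v i (ordS j))].
  move=> jm; apply/setP=> x; rewrite suppb in_setI in_set2; apply/andP/orP.
    case=> xs /bigcupP[i' _ /imsetP[j' _ ex]]; move: xs; rewrite ex mem_supp.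
    by case/(K0 i j i' j' jm) => ->; [left|right].
  by case=> /eqP->; rewrite mem_supp adjE eqxx ?orbT.
have K3 i j : supp (b i j) :&: U i = [set phi (v i j); phi (v i (ordS j))].
  have sU : U i \subset Ut by apply: (bigcup_sup i).
  by rewrite suppb -setIA (setIidPr sU); apply: unrolled_supp (un i).
pose l i := phi (v i ord_max).
have maxS n : ordS (@ord_max n) = ord0 by apply: val_inj; rewrite /= modnn.
have vmax i : v i ord_max != r.
  by rewrite -(v0 i) (inj_eq (iv i)) -val_eqE /= -lt0n.
have il : injective l.
  move=> i j /phi_inj e; apply/eqP; apply: contraT => ij.
  have := disj i j _ ij (vL i _ (vmax i)); by rewrite e vL.
pose Fp i := [set b i (widen_ord (leqnSn (m i)) j) | j : 'I_(m i)].
pose h' := b ord0 ord_max.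
have bmax i : b i ord_max = h' by apply: val_inj; rewrite /= !amax.
have widenP i (j : 'I_(m i).+1) : j != ord_max ->
    exists j', j = widen_ord (leqnSn (m i)) j'.
  move=> jm; have jlt : (j < m i)%N.
    by rewrite ltn_neqAle -ltnS ltn_ord andbT; apply: contra jm => /eqP e; apply/eqP/val_inj.
  by exists (Ordinal jlt); apply: val_inj.
have nmax i (j : 'I_(m i)) : widen_ord (leqnSn (m i)) j != ord_max.
  by rewrite -val_eqE /= neq_ltn ltn_ord.
have ws i (j : 'I_(m i)) : ordS (widen_ord (leqnSn (m i)) j) = lift ord0 j.
  by apply: val_inj; rewrite /= modn_small // ltnS.
have hFp i : h' |: Fp i = [set b i j | j : 'I_(m i).+1].
  apply/setP=> x; rewrite in_setU1; apply/orP/imsetP.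
    case=> [/eqP->|/imsetP[j _ ->]]; first by exists ord_max; rewrite ?bmax.
    by eexists.
  case=> j _ ->; have [->|/widenP[j' ->]] := eqVneq j ord_max.
    by left; rewrite bmax.
  by right; apply: imset_f.
exists V, H; split; last first.
  by apply: restr_contained; apply/bigcupsP=> i _; apply/subsetP=> x /imsetP[j _ ->].
exists h', (phi r), l, U, Fp; split.
- have eh : supp h' = phi r |: [set l i | i : 'I_3].
    apply/setP=> x; rewrite suppb in_setI in_setU1 amax; apply/andP/orP.
      case=> xs /bigcupP[i' _ /imsetP[j' _ ex]]; move: xs.
      rewrite ex mem_supp -(amax i') adjE maxS => /orP[] /eqP->.
        by right; apply: imset_f.
      by left; rewrite v0.
    case=> [/eqP->|/imsetP[i _ ->]].
      by rewrite mem_supp rh -(v0 ord0) vUt.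
    by rewrite mem_supp -(amax i) adjE eqxx vUt.
  split=> //; rewrite eh cardsU1 card_imset // card_ord.
  rewrite (_ : _ \notin _ = true) //; apply/imsetP => -[i _ /phi_inj e].
  by have := vmax i; rewrite -e eqxx.
- split=> //; apply/setP=> x; rewrite !inE; apply/esym.
  have /andP[/bigcupP[i _ /imsetP[j _ ex]] _] := valP x.
  have -> : x = b i j by apply: val_inj.
  have [->|/widenP[j' ->]] := eqVneq j ord_max; first by rewrite bmax eqxx.
  by apply/orP; right; apply/bigcupP; exists i => //; apply: imset_f.
- move=> i; have sub c : c \in Fp i -> supp c \subset U i.
    case/imsetP=> j _ ->; rewrite K1 ?nmax //.
    by apply/subsetP=> x; rewrite !inE => /orP[] /eqP->.
  split=> //; rewrite -(v0 i).
  apply: (restr_mixed_path (v := fun j => phi (v i j))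
    (a := fun j => b i (widen_ord (leqnSn (m i)) j))).
  + exact: inj_comp phi_inj (iv i).
  + by move=> j j' /ib /(congr1 val) /= e; apply: val_inj.
  + by move=> j; rewrite K3 ws.
- move=> i j ij; rewrite disjoint_subset; apply/subsetP=> x.
  rewrite !inE => /andP[xr /imsetP[p _ ex]]; apply/negP => /andP[_ /imsetP[q _ ey]].
  have e : v i p = v j q by apply: phi_inj; rewrite -ex.
  have pr : v i p != r by apply: contraNneq xr => <-; rewrite ex.
  by have := disj i j _ ij (vL i _ pr); rewrite e vL // -e.
- move=> i; rewrite hFp.
  have [cyc par] := restr_mixed_cycle (m := (m i).+1) (v := fun j => phi (v i j))
    (m0 i) (inj_comp phi_inj (iv i)) (ib i) (K3 i).
  split=> //; move: par.
  under eq_bigr do rewrite !incidence_restr ?vUt // -!entryE.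
  by have [_ _ _ _ <-] := un i; rewrite even; case: odd_parity.
Qed.

End Realize.

(** * Necessity *)

Lemma totally_unimodularP m n (M : 'M[int]_(m, n)) :
  totally_unimodular M <-> forall k (f : 'I_k -> 'I_m) (g : 'I_k -> 'I_n),
    injective f -> injective g -> ternary (\det (mxsub f g M)).
Proof.
split=> h k f g fi gi; have := h k f g fi gi.
  by case=> ->.
by case/or3P=> /eqP; [constructor 1|constructor 2|constructor 3].
Qed.

(** If the rows were independent, a square matrix on all of them would have
    determinant 1 or -1.  But its rows add up to twice an integral vector, and
    multiplying by its adjugate shows that the determinant is even. *)
Lemma even_columns_dependent m n (M : 'M[int]_(m, n)) : (0 < m)%N ->
  totally_unimodular M -> (forall j, exists q, \sum_i M i j = 2 * q) ->
  ~~ row_free (ratmx M).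
Proof.
move=> m0 /totally_unimodularP tu ev; apply/negP => /int_row_free_minor[g gi dg].
have := tu m id g (fun _ _ => id) gi => /ternary_pm1/(_ dg) dpm.
pose B := colsub g M; pose u : 'rV[int]_m := const_mx 1.
have /fin_all_exists[q eq] : forall j : 'I_m, exists q, \sum_i M i (g j) = 2 * q.
  by move=> j; apply: ev.
have e : u *m B = 2 *: \row_j q j.
  apply/rowP=> j; rewrite !mxE -eq; apply: eq_bigr => i _.
  by rewrite !mxE mul1r.
have := congr1 (fun Z => (Z *m \adj B) 0 (Ordinal m0)) e.
rewrite -mulmxA mul_mx_adj mul_mx_scalar -scalemxAl [LHS]mxE [RHS]mxE mxE mulr1.
move: dpm; rewrite -/B; move: (\det B) (_ 0 _) => d z; rewrite /pm1; clear; lia.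
Qed.

Section Contained.
Variables (V W : finType) (D : mixed_hypergraph V) (H : mixed_hypergraph W).

Lemma contained_incidence : contains D H -> exists f g,
  [/\ injective f, injective g & incidence_mx H = mxsub f g (incidence_mx D)].
Proof.
case=> K [[sub [iota [iinj es et]]] [phi [psi [bphi bpsi hs ht]]]].
pose x (i : 'I_#|vert H|) : {x | x \in vert H} :=
  exist (fun x => x \in vert H) (enum_val i) (enum_valP i).
pose y i := val (phi (x i)).
have yK i : y i \in vert K by apply: valP.
have yD i : y i \in vert D by apply: (subsetP sub).
pose f i := enum_rank_in (yD i) (y i).
pose g (j : 'I_#|{: arc H}|) := enum_rank (iota (psi (enum_val j))).
have fE i : enum_val (f i) = y i by apply: enum_rankK_in.
exists f, g; split.
- move=> i i' /(congr1 enum_val); rewrite !fE => /val_inj/(bij_inj bphi)/(congr1 val) /=.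
  exact: enum_val_inj.
- by move=> j j' /enum_rank_inj/iinj/(bij_inj bpsi)/enum_val_inj.
apply/matrixP=> i j; rewrite !mxE fE enum_rankK /incidence.
rewrite -[_ \in src (enum_val j)]/(val (x i) \in _) -[_ \in tgt (enum_val j)]/(val (x i) \in _).
by rewrite -hs -ht es et !inE -/(y i) yK !andbT.
Qed.

Lemma contained_tu : contains D H -> totally_unimodular (incidence_mx D) ->
  totally_unimodular (incidence_mx H).
Proof.
case/contained_incidence=> f [g [fi gi ->]] tu k f' g' fi' gi'.
have -> : mxsub f' g' (mxsub f g (incidence_mx D)) =
    mxsub (f \o f') (g \o g') (incidence_mx D) by apply/matrixP=> i j; rewrite !mxE.
by apply: tu; apply: inj_comp.
Qed.

End Contained.

Section Obstructions.
Variables (V : finType) (H : mixed_hypergraph V).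

Definition rat_incidence (v : V) (a : arc H) : rat := (incidence v a)%:~R.

Definition balanced (Y : V -> rat) :=
  forall a : arc H, \sum_(v in supp a) Y v * rat_incidence v a = 0.

(** Contrapositive of [even_columns_dependent] for incidence matrices; a
    balanced Y is a linear relation between the rows. *)
Lemma even_independent_not_tu : vert H != set0 ->
  (forall a : arc H, ~~ odd #|supp a|) ->
  (forall Y, balanced Y -> {in vert H, forall v, Y v = 0}) ->
  ~ totally_unimodular (incidence_mx H).
Proof.
move=> /set0Pn[x0 x0H] ev ind tu.
have v0 : (0 < #|vert H|)%N by rewrite card_gt0; apply/set0Pn; exists x0.
have sumE (T : nmodType) (f : V -> T) (a : arc H) : (forall v, v \notin supp a -> f v = 0) ->
    \sum_(v in vert H) f v = \sum_(v in supp a) f v.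
  move=> f0; rewrite big_mkcond [RHS]big_mkcond /=; apply: eq_bigr => v _.
  have [va|/f0->] := boolP (v \in supp a); last by case: ifP.
  by rewrite (subsetP (supp_sub a)).
have ev2 j : exists q, \sum_i incidence_mx H i j = 2 * q.
  pose a : arc H := enum_val j.
  exists ((#|supp a|./2)%:Z - #|[set v in supp a | incidence v a == -1]|%:Z).
  under eq_bigr do rewrite mxE.
  rewrite -(big_enum_val (fun v => incidence v a)) (sumE _ _ a); last first.
    by move=> v; rewrite -incidence_neq0 negbK => /eqP.
  rewrite pm1_sum; last first.
    by move=> v va; apply: ternary_pm1 (incidence_ternary _ _) _; rewrite incidence_neq0.
  have := ev a; move: #|supp a| #|_| => p q; clear; lia.
have /negP := even_columns_dependent v0 tu ev2; apply.
apply: inj_row_free => y hy.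
pose Y v := y 0 (enum_rank_in x0H v).
have hY : balanced Y.
  move=> a; rewrite -sumE; last first.
    by move=> v; rewrite -incidence_neq0 negbK /rat_incidence => /eqP->; rewrite mulr0.
  have := congr1 (fun Z : 'rV_ _ => Z 0 (enum_rank a)) hy; rewrite !mxE => h.
  apply: etrans h; rewrite big_enum_val; apply: eq_bigr => i _; rewrite /Y enum_valK_in !mxE.
  by rewrite enum_rankK.
apply/rowP=> i; have := ind Y hY _ (enum_valP i).
by rewrite /Y enum_valK_in mxE.
Qed.

Lemma balanced_edge Y (a : arc H) x y : balanced Y -> x != y -> supp a = [set x; y] ->
  Y y = (-1) ^+ par a * Y x.
Proof.
move=> /(_ a) hY xy e; move: hY; rewrite e big_setU1 ?inE //= big_set1.
have := par_in_sign (U := setT) xy (etrans (setIT _) e).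
rewrite /par_in !setIT -/(par a) => ep.
have ix : x \in supp a by rewrite e !inE eqxx.
have iy : y \in supp a by rewrite e !inE eqxx orbT.
have : (-1) ^+ par a = - rat_incidence x a * rat_incidence y a.
  have := congr1 (fun z : int => z%:~R : rat) ep.
  by rewrite intrM rmorphN rmorphXn /= rmorphN1.
move=> -> h; have iy2 : rat_incidence y a * rat_incidence y a = 1.
  by rewrite /rat_incidence -intrM pm1_sqr // ternary_pm1 ?incidence_ternary // incidence_neq0.
rewrite -[LHS]mulr1 -iy2.
have -> : Y y * (rat_incidence y a * rat_incidence y a) = (Y x * rat_incidence x a + Y y * rat_incidence y a) * rat_incidence y a
    + (- rat_incidence x a * rat_incidence y a) * Y x by ring.
by rewrite h mul0r add0r.
Qed.

Lemma alternating_chain (y : nat -> rat) (p : nat -> nat) n :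
  (forall i, (i < n)%N -> y i.+1 = (-1) ^+ p i * y i) ->
  forall i, (i <= n)%N -> y i = (-1) ^+ (\sum_(j < i) p j) * y 0%N.
Proof.
move=> h; elim=> [|i IH] ni; first by rewrite big_ord0 mul1r.
by rewrite h // IH ?(ltnW ni) // big_ord_recr /= mulrA -exprD addnC.
Qed.

End Obstructions.

Section Cycle.
Variables (V : finType) (C : mixed_hypergraph V).

(** A balanced Y returns with the opposite sign after one turn around the
    cycle. *)
Lemma odd_cycle_not_tu : mixed_odd_cycle C -> ~ totally_unimodular (incidence_mx C).
Proof.
case=> -[n [v [e [n2 iv be hv he]]]] oddC.
case: n n2 v e iv be hv he => // m m1 v e iv be hv he.
have vS i : v i != v (ordS i) by rewrite (inj_eq iv) ordS_neq.
have se i : supp (e i) = [set v i; v (ordS i)] := he i.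
have vH : vert C = [set v i | i : 'I_m.+1] := hv.
apply: even_independent_not_tu.
- by rewrite vH; apply/set0Pn; exists (v ord0); apply: imset_f.
- move=> a; have [f ef fe] := be; rewrite -(fe a) se cards2 vS //.
move=> Y bY; pose y i := Y (v (inord (i %% m.+1))).
have chain := @alternating_chain y (fun i => par (e (inord (i %% m.+1)))) m.+1.
have yE (i : 'I_m.+1) : y i = Y (v i) by rewrite /y modn_small // inord_val.
have hy i : (i < m.+1)%N -> y i.+1 = (-1) ^+ par (e (inord (i %% m.+1))) * y i.
  move=> im; rewrite -[i]/(val (Ordinal im)) yE modn_small // inord_val.
  rewrite -(balanced_edge bY (vS _) (se _)) /y; congr (Y (v _)).
  by apply: val_inj; rewrite /= inordK // ltn_mod.
have {}chain := chain hy.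
have y0 : y 0%N = 0.
  have := chain m.+1 (leqnn _); rewrite {1}/y modnn -{1}(mod0n m.+1) -/(y 0%N).
  have -> : (\sum_(j < m.+1) par (e (inord (j %% m.+1))))%N = (\sum_(a : arc C) par a)%N.
    rewrite [RHS](reindex e) /=; last by case: be => f ef fe; exists f => ? _.
    by apply: eq_bigr => i _; rewrite modn_small // inord_val.
  rewrite -signr_odd [odd _]oddC expr1 mulN1r => /eqP.
  by rewrite -subr_eq0 opprK -mulr2n mulrn_eq0 /= => /eqP.
move=> x; rewrite vH => /imsetP[i _ ->].
by rewrite -yE chain 1?ltnW // y0 mulr0.
Qed.

End Cycle.

Lemma sum_over_sig (I : finType) (P : pred I) (F : I -> nat) :
  (\sum_(x : {a | P a}) F (val x) = \sum_(a | P a) F a)%N.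
Proof.
rewrite [RHS](reindex_omap (val : {a | P a} -> I) insub) /=; last first.
  by move=> i Pi; rewrite insubT.
by apply: eq_bigl=> -[i Pi]; rewrite /= insubT Pi /= eqxx.
Qed.

Section House.
Variables (V : finType) (H : mixed_hypergraph V).

Lemma par_restr (U : {set V}) (F : {set arc H}) (a : arc (restr U F)) :
  par a = par_in U (val a).
Proof. by []. Qed.

Lemma sum_par_add (U : {set V}) (F : {set arc H}) h : h \notin F ->
  supp h :&: U != set0 ->
  (\sum_(a : arc (restr U (h |: F))) par a
   = par_in U h + \sum_(a : arc (restr U F)) par a)%N.
Proof.
move=> hF hU.
rewrite (sum_over_sig _ (par_in U)) (sum_over_sig _ (par_in U)) (bigD1 h) /=; last first.
  by apply: restr_arcP => //; rewrite setU11.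
congr (_ + _)%N; apply: eq_bigl => a; rewrite in_setU1.
by have [->|_] := eqVneq a h; rewrite ?andbF ?(negbTE hF) //= andbT.
Qed.

(** A balanced Y is determined along a path by its value at the start, and
    the sign at the end is given by the parity of the path. *)
Lemma path_balanced (U : {set V}) (F : {set arc H}) s t Y :
  {in F, forall a, supp a \subset U} -> mixed_path (restr U F) s t ->
  balanced H Y ->
  [/\ Y t = (-1) ^+ (\sum_(a : arc (restr U F)) par a)%N * Y s,
      {in U, forall x, Y s = 0 -> Y x = 0}, s \in U, t \in U
    & {in F, forall a, #|supp a| = 2%N}].
Proof.
move=> sub [n [v [e [iv be hv he [v0 vn]]]]] bY.
have eU : U = [set v i | i : 'I_n.+1] := hv.
have sv j : supp (val (e j)) = [set v (widen_ord (leqnSn n) j); v (lift ord0 j)].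
  have /andP[eF _] := valP (e j).
  by rewrite -[LHS](setIidPl (sub _ eF)) -supp_restr; apply: he.
have vv (j : 'I_n) : v (widen_ord (leqnSn n) j) != v (lift ord0 j).
  by rewrite (inj_eq iv) -val_eqE /= /bump leq0n add1n neq_ltn ltnSn.
have pv j : par (val (e j)) = par (e j).
  have /andP[eF _] := valP (e j); rewrite par_restr /par_in.
  have := sub _ eF; rewrite subUset => /andP[h1 h2].
  by rewrite (setIidPl h1) (setIidPl h2).
pose y i := Y (v (inord i)).
pose p i := if insub i is Some j then par (e j) else 0%N.
have yE (i : 'I_n.+1) : y i = Y (v i) by rewrite /y inord_val.
have hy i : (i < n)%N -> y i.+1 = (-1) ^+ p i * y i.
  move=> ni; rewrite /p insubT /= -pv.
  have := balanced_edge bY (vv (Ordinal ni)) (sv _); rewrite -!yE /=.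
  by rewrite /bump leq0n add1n.
have chain := alternating_chain hy.
have y0 : y 0%N = Y s by rewrite -v0 -yE.
split.
- rewrite -vn -yE chain //= y0; congr (_ ^+ _ * _).
  rewrite [RHS](reindex e) /=; last by case: be => f ef fe; exists f => ? _.
  by apply: eq_bigr => i _; rewrite /p valK.
- move=> x; rewrite eU => /imsetP[i _ ->] s0.
  by rewrite -yE (chain i (ltn_ord i)) y0 s0 mulr0.
- by rewrite eU -v0 imset_f.
- by rewrite eU -vn imset_f.
move=> a aF; have ne : supp a :&: U != set0.
  by rewrite (setIidPl (sub _ aF)); apply: src_tgt_neq0.
have [f ef fe] := be.
have -> : a = val (e (f (exist _ a (restr_arcP aF ne)))) by rewrite fe.
by rewrite sv cards2 vv.
Qed.

(** As the three cycles are even, each leaf contributes to the balance of Y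
    at h the opposite of the contribution of r.  So the total is minus twice
    that of r, and Y vanishes at r and then along the paths. *)
Lemma tree_house_not_tu : mixed_tree_house H -> ~ totally_unimodular (incidence_mx H).
Proof.
case=> h [r [l [U [F [[eh ch] [eV eA] hF disj hev]]]]].
have [rl il] : r \notin [set l i | i : 'I_3] /\ injective l.
  have : (#|[set l i | i : 'I_3]| <= 3)%N.
    by rewrite -[X in (_ <= X)%N](card_ord 3); apply: leq_imset_card.
  move: ch; rewrite eh cardsU1; case: (r \notin _) => /=; last by clear; lia.
  move=> c3 _; split=> //.
  have /imset_injP il : #|[set l i | i : 'I_3]| == #|'I_3| by rewrite card_ord; apply/eqP; move: c3; clear; lia.
  by move=> i j; apply: il.
have bal Y i : balanced H Y -> _ :=
  path_balanced (proj1 (hF i)) (proj2 (hF i)) (Y := Y).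
have b0 : balanced H (fun=> 0) by move=> a; apply: big1 => v _; rewrite mul0r.
have rU i : r \in U i by case: (bal _ i b0).
have lU i : l i \in U i by case: (bal _ i b0).
have F2 i : {in F i, forall a, #|supp a| = 2%N} by case: (bal _ i b0).
have lr i : l i != r by apply: contraNneq rl => <-; apply: imset_f.
have lnU i j : i != j -> l i \notin U j.
  move=> ij; have /pred0P/(_ (l i)) := disj i j ij.
  by rewrite /= !inE lr lU /= => ->.
have hUi i : supp h :&: U i = [set r; l i].
  apply/setP=> x; rewrite eh in_setI in_setU1 in_set2; apply/andP/orP.
    case=> /orP[->|/imsetP[j _ ->] lj]; first by left.
    by have [->|ji] := eqVneq j i; [right|rewrite (negbTE (lnU _ _ ji)) in lj].
  by case=> /eqP->; rewrite ?eqxx ?rU ?lU ?imset_f ?orbT.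
have hnF i : h \notin F i.
  by apply/negP=> /F2; rewrite ch.
apply: even_independent_not_tu.
- by rewrite eV; apply/set0Pn; exists r; apply/bigcupP; exists ord0.
- move=> a; have : a \in [set: arc H] by rewrite inE.
  rewrite eA in_setU1 => /orP[/eqP->|/bigcupP[i _ /F2->]] //.
  by rewrite ch.
move=> Y bY.
have Yl i : Y (l i) * rat_incidence (l i) h = - (Y r * rat_incidence r h).
  have [-> _ _ _ _] := bal Y i bY.
  have /negP := proj2 (hev i); rewrite /odd_parity sum_par_add //; last first.
    by rewrite hUi; apply/set0Pn; exists r; rewrite !inE eqxx.
  move: (\sum_(a : _) _)%N => P; rewrite oddD => ep.
  have -> : (-1) ^+ P = (-1) ^+ par_in (U i) h :> rat.
    rewrite -signr_odd -[RHS]signr_odd; congr (_ ^+ _).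
    by move: ep; case: odd; case: odd.
  have rli : r != l i by rewrite eq_sym.
  have := congr1 (fun z : int => z%:~R : rat) (par_in_sign rli (hUi i)).
  rewrite rmorphXn /= rmorphN1 => ->; rewrite intrM rmorphN /= -/(rat_incidence r h) -/(rat_incidence (l i) h).
  have : rat_incidence (l i) h * rat_incidence (l i) h = 1.
    rewrite /rat_incidence -intrM pm1_sqr // ternary_pm1 ?incidence_ternary // incidence_neq0.
    by rewrite eh in_setU1 imset_f ?orbT.
  move: (rat_incidence (l i) h) (rat_incidence r h) (Y r) => b c z bb.
  have -> : - c * b * z * b = - (z * c) * (b * b) by ring.
  by rewrite bb mulr1.
have Yr : Y r = 0.
  have := bY h; rewrite eh big_setU1 //= big_imset /=; last by move=> i j _ _ /il.
  under eq_bigr do rewrite Yl.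
  rewrite sumr_const card_ord => e.
  have : Y r * rat_incidence r h == 0.
    (* The balance at h is c - 3 c = - 2 c for the contribution c of r. *)
    have -> : Y r * rat_incidence r h = - (1 / 2%:R) * (Y r * rat_incidence r h + (- (Y r * rat_incidence r h)) *+ 3).
      by field.
    by rewrite e mulr0.
  rewrite mulf_eq0 /rat_incidence intr_eq0 => /orP[/eqP//|hr].
  by have := incidence_neq0 r h; rewrite hr eh setU11.
move=> x; rewrite eV => /bigcupP[i _ xU].
by have [_ h0 _ _ _] := bal Y i bY; apply: h0.
Qed.

End House.

(** * Sufficiency and the characterization *)

Section Sufficiency.
Variables (V : finType) (D : mixed_hypergraph V).
Hypothesis disjD : disjoint_mixed D.
Hypothesis no_odd_cycle : ~ exists (W : finType) (C : mixed_hypergraph W),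
  mixed_odd_cycle C /\ contains D C.
Hypothesis no_tree_house : ~ exists (W : finType) (H : mixed_hypergraph W),
  mixed_tree_house H /\ contains D H.

(** Induction on the order provides a matrix whose smaller minors are
    already known to be 0, 1 or -1. *)
Lemma submatrix_ternary k (f : 'I_k -> 'I_#|vert D|) (g : 'I_k -> 'I_#|{: arc D}|) :
  injective f -> injective g -> ternary (\det (mxsub f g (incidence_mx D))).
Proof.
have [n] := ubnP k; elim: n k f g => // n IH k f g kn fi gi.
apply: contraT => big; pose A := mxsub f g (incidence_mx D).
pose phi v := enum_val (f v) : V; pose psi c := enum_val (g c) : arc D.
have phi_inj : injective phi by move=> v v' /enum_val_inj/fi.
have psi_inj : injective psi by move=> c c' /enum_val_inj/gi.
have AE v c : A v c = incidence (phi v) (psi c) by rewrite !mxE.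
have entries v c : ternary (A v c) by rewrite AE incidence_ternary.
have minors k' (f' g' : 'I_k' -> 'I_k) : (k' < k)%N ->
    injective f' -> injective g' -> ternary (\det (mxsub f' g' A)).
  move=> k'k fi' gi'; rewrite (_ : mxsub f' g' A = mxsub (f \o f') (g \o g') (incidence_mx D)).
    by apply: IH; [apply: leq_trans k'k _ | exact: inj_comp | exact: inj_comp].
  by apply/matrixP=> i j; rewrite !mxE.
have suppE v c : (v \in colsupp A c) = (phi v \in supp (psi c)).
  by rewrite inE AE incidence_neq0.
have supp4 c : (4 <= #|colsupp A c|)%N -> (4 <= #|supp (psi c)|)%N.
  move/leq_trans; apply; rewrite -(card_imset _ phi_inj); apply: subset_leq_card.
  by apply/subsetP=> x /imsetP[v vc ->]; rewrite -suppE.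
have big_disjoint c c' v : c != c' -> (4 <= #|colsupp A c|)%N ->
    (4 <= #|colsupp A c'|)%N -> A v c != 0 -> A v c' = 0.
  move=> cc' /supp4 c4 /supp4 c4' vc; apply/eqP.
  have ne : psi c != psi c' by rewrite (inj_eq psi_inj).
  have := disjointFr (disjD ne c4 c4') (x := phi v).
  by rewrite -!suppE !inE => /(_ vc)/negbFE.
have phi_vert v : phi v \in vert D by apply: enum_valP.
case: (minimal_matrix_obstruction entries minors big big_disjoint) => [[s]|[r [h [L]]]].
  by move/(odd_hole_contained phi_inj psi_inj phi_vert AE)/no_odd_cycle.
by move/(tree_house_graph_contained phi_inj psi_inj phi_vert AE)/no_tree_house.
Qed.

End Sufficiency.

Theorem theorem1p5 (V : finType) (D : mixed_hypergraph V)
    (hD : disjoint_mixed D) :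
  totally_unimodular (incidence_mx D) <->
  ~ (exists (W : finType) (C : mixed_hypergraph W),
       mixed_odd_cycle C /\ contains D C) /\
  ~ (exists (W : finType) (H : mixed_hypergraph W),
       mixed_tree_house H /\ contains D H).
Proof.
split=> [tu|[nC nH]].
  split=> -[W [K [obs DK]]]; have := contained_tu DK tu.
    exact: odd_cycle_not_tu.
  exact: tree_house_not_tu.
apply/totally_unimodularP => k f g; exact: (submatrix_ternary hD nC nH).
Qed.
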